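(* Let $p$ be a prime number, let $\Gamma$ be a countable discrete group, and let $f \in \mathbb{Z}\Gamma$. Let $M_f = \mathbb{Z}\Gamma/\mathbb{Z}\Gamma f$ and let $X_f = \widehat{M_f}$ be its Pontrjagin dual. Then the following conditions are equivalent: (a) The group $X_f$ has bounded $p$-torsion. (b) There is an element $g \in c_0(\Gamma)$ with $gf = 1$. (c) $c_0(\Gamma) \otimes_{\mathbb{Z}\Gamma} M_f = 0$. If these equivalent conditions hold, then $\mathrm{Fix}_N(X_f)$ is finite for every normal subgroup $N$ of finite index in $\Gamma$. Moreover, if $\Gamma$ is residually finite, then conditions (a), (b), (c) are also equivalent to: (d) The element $f$ is a unit in $c_0(\Gamma)$.
   Context: $\mathbb{Z}\Gamma$ is the integral group ring of $\Gamma$, and $\mathbb{Z}\Gamma f$ is the left ideal generated by $f$. The quotient $M_f = \mathbb{Z}\Gamma/\mathbb{Z}\Gamma f$ is a left $\mathbb{Z}\Gamma$-module, with $\Gamma$ acting by left multiplication. The Pontrjagin dual $X_f = \widehat{M_f} = \mathrm{Hom}(M_f, \mathbb{R}/\mathbb{Z})$ of the discrete countable abelian group $M_f$ is a compact metrizable abelian group on which $\Gamma$ acts by topological group automorphisms (the action dual to that on $M_f$). Explicitly, if $f = \sum_\gamma a_\gamma \gamma$, then $X_f$ is the group of all families $(x_\gamma)_{\gamma\in\Gamma}$ with $x_\gamma \in \mathbb{R}/\mathbb{Z}$ such that $\sum_{\gamma'} a_{\gamma'} x_{\gamma\gamma'} = 0$ in $\mathbb{R}/\mathbb{Z}$ for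 all $\gamma \in \Gamma$, with action $(\gamma x)_{\gamma'} = x_{\gamma^{-1}\gamma'}$. For a subgroup $N$ of $\Gamma$, $\mathrm{Fix}_N(X_f)$ is the set of points of $X_f$ fixed by every element of $N$. An abelian group $X$ has bounded $p$-torsion if there is an integer $i_0 \ge 0$ with $\mathrm{Ker}(p^i : X \to X) = \mathrm{Ker}(p^{i_0} : X \to X)$ for all $i \ge i_0$. $c_0(\Gamma)$ denotes the $\mathbb{Q}_p$-Banach algebra of all formal series $\sum_{\gamma\in\Gamma} x_\gamma \gamma$ with $x_\gamma \in \mathbb{Q}_p$ and $|x_\gamma|_p \to 0$ as $\gamma \to \infty$ (i.e. for every $\varepsilon>0$ only finitely many $\gamma$ satisfy $|x_\gamma|_p \ge \varepsilon$), with norm $\|x\| = \max_\gamma |x_\gamma|_p$ and the multiplication (convolution) extending that of the group ring. It contains $\mathbb{Z}\Gamma$ as a subring, so it is a right $\mathbb{Z}\Gamma$-module. The countable group $\Gamma$ is residually finite if it has a sequence $\Gamma_1, \Gamma_2, \ldots$ of normal subgroups of finite index with trivial intersection. *)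

(* Defs.v *)
From HB Require Import structures.
From mathcomp Require Import all_boot all_order all_algebra.
From mathcomp Require Import finmap.
From mathcomp Require Import monalg.
From mathcomp Require Import all_classical all_reals.
From mathcomp Require Import zify ring lra.

Set Implicit Arguments.
Unset Strict Implicit.
Unset Printing Implicit Defensive.

Import Order.TTheory GRing.Theory Num.Theory.

Local Open Scope ring_scope.

Section PadicAbs.
Variables (p : nat) (p_pr : prime p).

Definition padic_abs (x : rat) : rat :=
  if x == 0 then 0
  else p%:Q ^ ((logn p `|denq x|)%:Z - (logn p `|numq x|)%:Z).

Let p_gt0 : (0 : rat) < p%:Q. Proof. by rewrite ltr0n prime_gt0. Qed.
Let p_neq0 : p%:Q != 0 :> rat. Proof. by rewrite gt_eqF. Qed.
Let p_gt1 : (1 : rat) < p%:Q. Proof. by rewrite ltr1n prime_gt1. Qed.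

Lemma padic_abs0 : padic_abs 0 = 0. Proof. by rewrite /padic_abs eqxx. Qed.

Lemma padic_abs_frac (m n : int) : m != 0 -> n != 0 ->
  padic_abs (m%:~R / n%:~R) = p%:Q ^ ((logn p `|n|)%:Z - (logn p `|m|)%:Z).
Proof.
move=> m0 n0; rewrite /padic_abs mulf_eq0 invr_eq0 !intr_eq0.
rewrite (negPf m0) (negPf n0) /=; set x := _ / _.
have x0 : x != 0 by rewrite mulf_neq0 ?invr_eq0 ?intr_eq0.
have E : numq x * n = m * denq x.
  apply/eqP; rewrite -(eqr_int rat) !rmorphM /= numqE -/x.
  by rewrite mulrAC /x divfK ?intr_eq0.
have E2 : (logn p `|numq x| + logn p `|n| = logn p `|m| + logn p `|denq x|)%N.
  rewrite -!lognM ?absz_gt0 ?numq_eq0 ?denq_eq0 //.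
  by rewrite -!abszM E.
congr (_ ^ _); lia.
Qed.

Lemma padic_abs_neq0 x : x != 0 -> 0 < padic_abs x.
Proof. by move=> x0; rewrite /padic_abs (negPf x0) exprz_gt0. Qed.

Lemma padic_abs_ge0 x : 0 <= padic_abs x.
Proof.
by have [->|/padic_abs_neq0/ltW//] := eqVneq x 0; rewrite padic_abs0.
Qed.

Lemma padic_absM x y : padic_abs (x * y) = padic_abs x * padic_abs y.
Proof.
have [->|x0] := eqVneq x 0; first by rewrite mul0r padic_abs0 mul0r.
have [->|y0] := eqVneq y 0; first by rewrite mulr0 padic_abs0 mulr0.
rewrite -[x in LHS]divq_num_den -[y in LHS]divq_num_den mulrACA -invfM.
rewrite -!rmorphM padic_abs_frac ?mulf_neq0 ?numq_eq0 ?denq_eq0 //.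
rewrite /padic_abs (negPf x0) (negPf y0) -expfzDr // !abszM.
rewrite !lognM ?absz_gt0 ?numq_eq0 ?denq_eq0 //.
move: (logn p `|numq x|) (logn p `|denq x|) (logn p `|numq y|) (logn p `|denq y|) => a b c d; apply: (congr1 (fun k => _ ^ k)); lia.
Qed.

Lemma padic_absN x : padic_abs (- x) = padic_abs x.
Proof. by rewrite /padic_abs oppr_eq0 numqN denqN abszN. Qed.

Lemma padic_abs1 : padic_abs 1 = 1.
Proof. by rewrite /padic_abs oner_eq0 -[1]/(1%:~R) numq_int denq_int !logn1 subrr expr0z. Qed.

Lemma logn_addz (a b : int) k : a + b != 0 ->
  (a != 0 -> k <= logn p `|a|)%N -> (b != 0 -> k <= logn p `|b|)%N ->
  (k <= logn p `|(a + b)%R|)%N.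
Proof.
move=> ab0 Ha Hb.
have H (c : int) : (c != 0 -> (k <= logn p `|c|)%N) -> (p ^ k %| `|c|)%N.
  have [->|c0 /(_ isT)] := eqVneq c 0; first by rewrite dvdn0.
  by rewrite pfactor_dvdn // absz_gt0.
have: (p ^ k %| `|(a + b)%R|)%N.
  suff: (Posz (p ^ k)%N %| a + b)%Z by [].
  by apply: rpredD; apply: H.
by rewrite pfactor_dvdn // absz_gt0.
Qed.

Lemma padic_absD_le x y e :
  padic_abs x <= e -> padic_abs y <= e -> padic_abs (x + y) <= e.
Proof.
have [->|x0] := eqVneq x 0; first by rewrite add0r.
have [->|y0] := eqVneq y 0; first by rewrite addr0.
have [->|xy0 hx hy] := eqVneq (x + y) 0.
  by move=> ?; rewrite padic_abs0 => ?; apply: le_trans (padic_abs_ge0 y) _.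
have E : x + y = (numq x * denq y + numq y * denq x)%:~R / (denq x * denq y)%:~R.
  rewrite -[x in LHS]divq_num_den -[y in LHS]divq_num_den.
  by rewrite addf_div ?intr_eq0 ?denq_eq0 // rmorphD !rmorphM.
have s0 : numq x * denq y + numq y * denq x != 0.
  by apply: contra_neq xy0; rewrite E => ->; rewrite mul0r.
rewrite E padic_abs_frac ?mulf_neq0 ?denq_eq0 //.
have := hx; rewrite /padic_abs (negPf x0); have := hy.
rewrite /padic_abs (negPf y0).
set dx := denq x; set dy := denq y; set nx := numq x; set ny := numq y.
rewrite !abszM !lognM ?absz_gt0 ?denq_eq0 //.
set a := logn p `|dx|; set b := logn p `|dy|.
set c := logn p `|nx|; set d := logn p `|ny|.
pose k := minn (c + b) (d + a).
have Hk : (k <= logn p `|(nx * dy + ny * dx)%R|)%N.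
  apply: logn_addz => // _; rewrite abszM lognM ?absz_gt0 ?numq_eq0 ?denq_eq0 //.
    exact: geq_minl.
  exact: geq_minr.
move=> h1 h2; apply: (le_trans (y := p%:Q ^ ((a + b)%N%:Z - k%:Z))).
  by apply: ler_weXz2l; [exact: ltW | lia].
have [h|h] := leqP (c + b) (d + a).
  apply: le_trans h2; apply: ler_weXz2l; first exact: ltW.
  by rewrite /k; lia.
apply: le_trans h1; apply: ler_weXz2l; first exact: ltW.
by rewrite /k; lia.
Qed.

Lemma padic_absD_lt x y e :
  padic_abs x < e -> padic_abs y < e -> padic_abs (x + y) < e.
Proof.
move=> hx hy; apply: le_lt_trans (_ : Num.max (padic_abs x) (padic_abs y) < e).
  by apply: padic_absD_le; rewrite le_max lexx ?orbT.
by rewrite gt_max hx.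
Qed.

Lemma padic_absB_lt x y e :
  padic_abs x < e -> padic_abs y < e -> padic_abs (x - y) < e.
Proof. by move=> hx hy; rewrite padic_absD_lt ?padic_absN. Qed.

Lemma padic_abs_eq x y : padic_abs (x - y) < padic_abs x ->
  padic_abs y = padic_abs x.
Proof.
move=> h; apply/eqP; rewrite eq_le; apply/andP; split.
  by rewrite -[y in leLHS](subKr x) padic_absD_le ?padic_absN // ltW.
rewrite leNgt; apply/negP => h2; have := padic_absD_lt h h2.
by rewrite subrK ltxx.
Qed.

End PadicAbs.

Section PadicField.
Variables (p : nat) (p_pr : prime p).

(* The primality proof is a phantom argument: it makes the closure instances
   below inferable. *)
Definition padic_cauchy of prime p : {pred nat -> rat} := fun x =>
  `[< forall e : rat, 0 < e -> exists N, forall m n,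
        (N <= m)%N -> (N <= n)%N -> padic_abs p (x m - x n) < e >].

Lemma padic_cauchyP x : reflect
  (forall e : rat, 0 < e -> exists N, forall m n,
     (N <= m)%N -> (N <= n)%N -> padic_abs p (x m - x n) < e)
  (x \in padic_cauchy p_pr).
Proof. exact: asboolP. Qed.

Lemma padic_cauchy_bounded x : x \in padic_cauchy p_pr ->
  exists2 C : rat, 0 < C & forall n, padic_abs p (x n) < C.
Proof.
move=> /padic_cauchyP/(_ 1 ltr01)[N HN].
pose C := 1 + \sum_(i < N.+1) padic_abs p (x i).
have leC i : (i <= N)%N -> padic_abs p (x i) < C.
  move=> iN; rewrite /C (bigD1 (Ordinal (iN : (i < N.+1)%N))) //= addrCA.
  by rewrite ltrDl ltr_pwDl // sumr_ge0 // => j _; apply: padic_abs_ge0.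
have C1 : 1 <= C.
  by rewrite lerDl sumr_ge0 // => j _; apply: padic_abs_ge0.
exists C; first exact: lt_le_trans C1.
move=> n; have [/leC//|Nn] := leqP n N.
rewrite -[x n](subrK (x N)); apply: padic_absD_lt => //; last exact: leC.
by apply: lt_le_trans C1; apply: HN => //; apply: ltnW.
Qed.

Lemma padic_cauchy_subring : subring_closed (padic_cauchy p_pr).
Proof.
split.
- apply/padic_cauchyP => e e0; exists 0%N => m n _ _.
  by rewrite subrr padic_abs0.
- move=> x y /padic_cauchyP hx /padic_cauchyP hy; apply/padic_cauchyP => e e0.
  have [N HN] := hx e e0; have [M HM] := hy e e0.
  exists (maxn N M) => m n; rewrite !geq_max => /andP[Nm Mm] /andP[Nn Mn].
  have -> : (x - y) m - (x - y) n = (x m - x n) - (y m - y n).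
    by rewrite !fctE; ring.
  by rewrite padic_absB_lt ?HN ?HM.
- move=> x y xC yC; apply/padic_cauchyP => e e0.
  have [A A0 HA] := padic_cauchy_bounded xC.
  have [B B0 HB] := padic_cauchy_bounded yC.
  move/padic_cauchyP: xC => hx; move/padic_cauchyP: yC => hy.
  have [N HN] := hx _ (divr_gt0 e0 B0); have [M HM] := hy _ (divr_gt0 e0 A0).
  exists (maxn N M) => m n; rewrite !geq_max => /andP[Nm Mm] /andP[Nn Mn].
  have -> : (x * y) m - (x * y) n = (x m - x n) * y m + x n * (y m - y n).
    by rewrite !fctE; ring.
  apply: padic_absD_lt => //; rewrite padic_absM //.
    rewrite -[e](divfK (lt0r_neq0 B0)).
    apply: ltr_pM; rewrite ?padic_abs_ge0 //; exact: HN.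
  rewrite mulrC -[e](divfK (lt0r_neq0 A0)).
  apply: ltr_pM; rewrite ?padic_abs_ge0 //; exact: HM.
Qed.

HB.instance Definition _ :=
  GRing.isSubringClosed.Build (nat -> rat) (padic_cauchy p_pr)
    padic_cauchy_subring.

Record cauchy_seq :=
  CauchySeq {cauchy_val :> nat -> rat; _ : cauchy_val \in padic_cauchy p_pr}.

HB.instance Definition _ := [isSub for cauchy_val].
HB.instance Definition _ := [Choice of cauchy_seq by <:].
HB.instance Definition _ := [SubChoice_isSubComNzRing of cauchy_seq by <:].

Lemma cauchy_val0 : cauchy_val 0 = 0. Proof. exact: (rmorph0 val). Qed.
Lemma cauchy_val1 : cauchy_val 1 = 1. Proof. exact: (rmorph1 val). Qed.
Lemma cauchy_valN : {morph cauchy_val : x / - x}.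
Proof. exact: (rmorphN val). Qed.
Lemma cauchy_valD : {morph cauchy_val : x y / x + y}.
Proof. exact: (rmorphD val). Qed.
Lemma cauchy_valM : {morph cauchy_val : x y / x * y}.
Proof. exact: (rmorphM val). Qed.
Definition cauchy_valE :=
  (cauchy_val0, cauchy_val1, cauchy_valN, cauchy_valD, cauchy_valM).

Definition padic_null : {pred cauchy_seq} := fun x =>
  `[< forall e : rat, 0 < e -> exists N, forall n,
        (N <= n)%N -> padic_abs p (x n) < e >].

Lemma padic_nullP (x : cauchy_seq) : reflect
  (forall e : rat, 0 < e -> exists N, forall n,
     (N <= n)%N -> padic_abs p (x n) < e)
  (x \in padic_null).
Proof. exact: asboolP. Qed.

Lemma padic_null_idealr : idealr_closed padic_null.
Proof.
split.
- apply/padic_nullP => e e0; exists 0%N => n _.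
  by rewrite cauchy_valE padic_abs0.
- apply/negP => /padic_nullP/(_ 1 ltr01)[N /(_ N (leqnn N))].
  by rewrite cauchy_valE padic_abs1 ltxx.
- move=> a x y /padic_nullP hx /padic_nullP hy; apply/padic_nullP => e e0.
  have [A A0 HA] := padic_cauchy_bounded (valP a).
  have [N HN] := hx _ (divr_gt0 e0 A0); have [M HM] := hy _ e0.
  exists (maxn N M) => n; rewrite !geq_max => /andP[Nn Mn].
  rewrite !cauchy_valE !fctE; apply: padic_absD_lt => //; last exact: HM.
  rewrite padic_absM // mulrC -[e](divfK (lt0r_neq0 A0)).
  apply: ltr_pM; rewrite ?padic_abs_ge0 //; exact: HN.
Qed.

HB.instance Definition _ := isIdealr.Build cauchy_seq padic_null padic_null_idealr.

(* The completion of the rationals for padic_abs: Cauchy sequences modulo null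
   sequences. *)
Definition Qp := {ideal_quot padic_null}.

HB.instance Definition _ := GRing.ComNzRing.on Qp.
End PadicField.

Section PadicNorm.
Variables (p : nat) (p_pr : prime p).
Local Notation cauchy_seq := (cauchy_seq p_pr).
Local Notation Qp := (Qp p_pr).
Local Notation padic_null := (@padic_null p p_pr).
Local Open Scope quotient_scope.
Implicit Types (x y : Qp) (u v : cauchy_seq).

(* The absolute value of a class is the limit of the absolute values along a
   representing Cauchy sequence (such a limit exists, see qp_norm_stat). *)
Definition qp_norm x : rat :=
  xget 0 [set a : rat | forall e : rat, 0 < e -> exists N, forall n,
            (N <= n)%N -> `|padic_abs p (repr x n) - a| < e]%classic.

Definition cauchy_const (q : rat) : cauchy_seq.
Proof.
exists (fun=> q); apply/padic_cauchyP => e e0.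
by exists 0%N => m n _ _; rewrite subrr padic_abs0.
Defined.

Lemma qp_pi_eq0 u : (\pi_Qp u == 0 :> Qp) = (u \in padic_null).
Proof. by rewrite piE Quotient.equivE subr0. Qed.

Lemma cauchy_stat u : u \notin padic_null ->
  exists2 a : rat, 0 < a &
    exists N, forall n, (N <= n)%N -> padic_abs p (u n) = a.
Proof.
move=> /padic_nullP nu.
have [e [e0 He]] : exists e : rat, 0 < e /\
    forall N, exists2 n, (N <= n)%N & e <= padic_abs p (u n).
  apply: contrapT => /forallNP H; apply: nu => e e0.
  have /not_andP[//|/existsNP[N HN]] := H e.
  exists N => n Nn; rewrite ltNge; apply/negP => h; apply: HN; by exists n.
have /padic_cauchyP/(_ e e0)[N HN] := valP u.
have [m Nm hm] := He N; exists (padic_abs p (u m)).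
  exact: lt_le_trans hm.
exists N => n Nn; apply: padic_abs_eq => //.
by apply: lt_le_trans hm; apply: HN.
Qed.

Lemma qp_norm_lim x (a : rat) :
  (forall e : rat, 0 < e -> exists N, forall n,
      (N <= n)%N -> `|padic_abs p (repr x n) - a| < e) -> qp_norm x = a.
Proof.
move=> Ha; apply: xget_unique => //= b Hb; apply/eqP; apply: contraT => ba.
have d0 : 0 < `|b - a| / 2 by rewrite divr_gt0 // normr_gt0 subr_eq0.
have [N HN] := Ha _ d0; have [M HM] := Hb _ d0.
have := HN (maxn N M) (leq_maxl _ _); have := HM (maxn N M) (leq_maxr _ _).
move: (padic_abs _ _) => c h1 h2; have := ltrD h1 h2.
rewrite -splitr distrC => /(le_lt_trans (ler_normD _ _)).
by rewrite addrA subrK ltxx.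
Qed.

Lemma qp_norm0 : qp_norm 0 = 0.
Proof.
apply: qp_norm_lim => e e0.
have /padic_nullP/(_ e e0)[N HN] : repr (0 : Qp) \in padic_null.
  by rewrite -qp_pi_eq0 reprK.
by exists N => n /HN; rewrite subr0 ger0_norm ?padic_abs_ge0.
Qed.

Lemma qp_norm_stat u (a : rat) N : 0 < a ->
  (forall n, (N <= n)%N -> padic_abs p (u n) = a) -> qp_norm (\pi u) = a.
Proof.
move=> a0 HN; apply: qp_norm_lim => e e0.
have /padic_nullP/(_ a a0)[M HM] : u - repr (\pi_Qp u) \in padic_null.
  by rewrite -qp_pi_eq0 raddfB /= reprK subrr.
exists (maxn N M) => n; rewrite geq_max => /andP[/HN un /HM].
rewrite !cauchy_valE -[_ n]/(u n - repr (\pi_Qp u) n) -un => /padic_abs_eq ->//.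
by rewrite un subrr normr0.
Qed.

Lemma qp_norm_lt u (e : rat) : 0 < e ->
  (qp_norm (\pi u) < e) <->
  exists N, forall n, (N <= n)%N -> padic_abs p (u n) < e.
Proof.
move=> e0; have [un|/cauchy_stat[a a0 [N HN]]] := boolP (u \in padic_null).
  have /eqP -> : \pi_Qp u == 0 by rewrite qp_pi_eq0.
  rewrite qp_norm0; split => // _; exact: (padic_nullP _ un).
rewrite (qp_norm_stat a0 HN); split => [ae|[M HM]].
  by exists N => n /HN ->.
by rewrite -(HN (maxn N M)) ?leq_maxl // HM // leq_maxr.
Qed.

Lemma qp_norm_cases x : x = 0 \/
  exists u (a : rat) N, [/\ x = \pi u, 0 < a, qp_norm x = a &
    forall n, (N <= n)%N -> padic_abs p (u n) = a].
Proof.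
have [xn|/cauchy_stat[a a0 [N HN]]] := boolP (repr x \in padic_null).
  by left; apply/eqP; rewrite -[x]reprK qp_pi_eq0.
right; exists (repr x), a, N; split=> //; first by rewrite reprK.
by rewrite -[in LHS](reprK x) (qp_norm_stat a0 HN).
Qed.

Lemma qp_norm_eq0 x : (qp_norm x == 0) = (x == 0).
Proof.
have [->|[u [a [N [xE a0 -> HN]]]]] := qp_norm_cases x.
  by rewrite qp_norm0 !eqxx.
rewrite (gt_eqF a0); apply/esym/negP => /eqP x0.
by move: (qp_norm_stat a0 HN); rewrite -xE x0 qp_norm0 => a00; rewrite -a00 ltxx in a0.
Qed.

Lemma qp_norm_ge0 x : 0 <= qp_norm x.
Proof.
have [->|[u [a [N [_ a0 -> _]]]]] := qp_norm_cases x; last exact: ltW.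
by rewrite qp_norm0.
Qed.

Lemma qp_norm_gt0 x : (0 < qp_norm x) = (x != 0).
Proof. by rewrite lt_neqAle qp_norm_ge0 andbT eq_sym qp_norm_eq0. Qed.

Lemma qp_normM x y : qp_norm (x * y) = qp_norm x * qp_norm y.
Proof.
have [->|[u [a [N [-> a0 -> HN]]]]] := qp_norm_cases x.
  by rewrite mul0r qp_norm0 mul0r.
have [->|[v [b [M [-> b0 -> HM]]]]] := qp_norm_cases y.
  by rewrite mulr0 qp_norm0 mulr0.
rewrite -rmorphM; apply: (@qp_norm_stat _ _ (maxn N M)).
  exact: mulr_gt0.
move=> n; rewrite geq_max => /andP[/HN un /HM vn].
by rewrite cauchy_valE -[_ n]/(u n * v n) padic_absM // un vn.
Qed.

Lemma qp_normN x : qp_norm (- x) = qp_norm x.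
Proof.
have [->|[u [a [N [-> a0 -> HN]]]]] := qp_norm_cases x; first by rewrite oppr0.
rewrite -raddfN; apply: (@qp_norm_stat _ _ N) => // n /HN.
by rewrite cauchy_valE -[(- _ : nat -> rat) n]/(- u n) padic_absN.
Qed.

Lemma qp_norm_const (q : rat) : qp_norm (\pi_Qp (cauchy_const q)) = padic_abs p q.
Proof.
have [->|q0] := eqVneq q 0.
  rewrite padic_abs0; apply/eqP; rewrite qp_norm_eq0 qp_pi_eq0.
  by apply/padic_nullP => e e0; exists 0%N => n _; rewrite padic_abs0.
by apply: (@qp_norm_stat _ _ 0); [exact: padic_abs_neq0|].
Qed.

Definition qp_of_rat (q : rat) : Qp := \pi_Qp (cauchy_const q).

Lemma qp_of_rat_zmod : zmod_morphism qp_of_rat.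
Proof.
move=> q r; rewrite /qp_of_rat -raddfB.
by suff -> : cauchy_const (q - r) = cauchy_const q - cauchy_const r;
  last by apply: val_inj; rewrite rmorphB.
Qed.

HB.instance Definition _ := GRing.isZmodMorphism.Build rat Qp qp_of_rat
  qp_of_rat_zmod.

Lemma qp_of_rat_monoid : monoid_morphism qp_of_rat.
Proof.
split=> [|q r]; rewrite /qp_of_rat.
  suff -> : cauchy_const 1 = 1 by rewrite rmorph1.
  by apply: val_inj; exact/esym/cauchy_val1.
rewrite -rmorphM.
by suff -> : cauchy_const (q * r) = cauchy_const q * cauchy_const r;
  last by apply: val_inj; rewrite rmorphM.
Qed.

HB.instance Definition _ := GRing.isMonoidMorphism.Build rat Qp qp_of_rat
  qp_of_rat_monoid.

Lemma qp_norm1 : qp_norm 1 = 1.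
Proof. by rewrite -(rmorph1 qp_of_rat) qp_norm_const padic_abs1. Qed.

Lemma qp_normD_lt x y (e : rat) :
  qp_norm x < e -> qp_norm y < e -> qp_norm (x + y) < e.
Proof.
move=> hx hy; have e0 : 0 < e by apply: le_lt_trans hx; apply: qp_norm_ge0.
move: hx hy; rewrite -[x]reprK -[y]reprK -raddfD.
move=> /(qp_norm_lt _ e0)[N HN] /(qp_norm_lt _ e0)[M HM].
apply/(qp_norm_lt _ e0); exists (maxn N M) => n.
rewrite geq_max => /andP[/HN un /HM vn].
by rewrite cauchy_valE; apply: padic_absD_lt.
Qed.

Lemma qp_normB_lt x y (e : rat) :
  qp_norm x < e -> qp_norm y < e -> qp_norm (x - y) < e.
Proof. by move=> hx hy; rewrite qp_normD_lt ?qp_normN. Qed.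

Lemma qp_norm_sum_lt (I : eqType) (r : seq I) (F : I -> Qp) (e : rat) : 0 < e ->
  (forall i, i \in r -> qp_norm (F i) < e) -> qp_norm (\sum_(i <- r) F i) < e.
Proof.
move=> e0 H; rewrite big_seq.
apply: (big_ind (fun x => qp_norm x < e)) => [|x y|//]; first by rewrite qp_norm0.
exact: qp_normD_lt.
Qed.

Lemma qp_eq0_small x : (forall e : rat, 0 < e -> qp_norm x < e) -> x = 0.
Proof.
move=> H; apply/eqP; apply: contraT; rewrite -qp_norm_gt0 => /H.
by rewrite ltxx.
Qed.

Lemma qp_dense x (e : rat) : 0 < e ->
  exists q, qp_norm (x - \pi_Qp (cauchy_const q)) < e.
Proof.
move=> e0; have /padic_cauchyP/(_ e e0)[N HN] := valP (repr x).
exists (repr x N); rewrite -[x in x - _]reprK -raddfB; apply/(qp_norm_lt _ e0).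
by exists N => n Nn; rewrite !cauchy_valE; apply: HN.
Qed.

Lemma qp_complete (X : nat -> Qp) :
  (forall e : rat, 0 < e -> exists N, forall m n,
     (N <= m)%N -> (N <= n)%N -> qp_norm (X m - X n) < e) ->
  exists L, forall e : rat, 0 < e -> exists N, forall n,
    (N <= n)%N -> qp_norm (X n - L) < e.
Proof.
move=> HX.
have inv0 n : 0 < n.+1%:R^-1 :> rat by rewrite invr_gt0 ltr0n.
have inv_small (e : rat) : 0 < e ->
    exists N, forall n, (N <= n)%N -> n.+1%:R^-1 < e.
  move=> e0; exists (Num.bound e^-1) => n Nn.
  rewrite -[e]invrK ltf_pV2 ?posrE ?invr_gt0 // ?ltr0n //.
  apply: lt_le_trans (_ : (Num.bound e^-1)%:R <= _).
    by apply: archi_boundP; rewrite invr_ge0 ltW.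
  by rewrite ler_nat ltnW.
have [q Hq] := choice (fun n => qp_dense (X n) (inv0 n)).
have qC : q \in padic_cauchy p_pr.
  apply/padic_cauchyP => e e0.
  have [N HN] := HX e e0; have [M HM] := inv_small e e0.
  exists (maxn N M) => m n; rewrite !geq_max => /andP[Nm Mm] /andP[Nn Mn].
  rewrite -qp_norm_const.
  have -> : \pi_Qp (cauchy_const (q m - q n)) =
      - (X m - \pi_Qp (cauchy_const (q m))) + (X m - X n)
      + (X n - \pi_Qp (cauchy_const (q n))).
    have -> : cauchy_const (q m - q n) = cauchy_const (q m) - cauchy_const (q n).
      by apply: val_inj; rewrite rmorphB.
    by rewrite raddfB /=; ring.
  apply: qp_normD_lt; last exact: lt_trans (Hq n) (HM n Mn).
  apply: qp_normD_lt; last exact: HN.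
  by rewrite qp_normN; exact: lt_trans (Hq m) (HM m Mm).
exists (\pi_Qp (CauchySeq qC)) => e e0.
have [M HM] := inv_small e e0.
have /padic_cauchyP/(_ e e0)[N HN] := qC.
exists (maxn N M) => n; rewrite !geq_max => /andP[Nn Mn].
rewrite -(subrK (\pi_Qp (cauchy_const (q n))) (X n)) -addrA.
apply: qp_normD_lt; first exact: lt_trans (Hq n) (HM n Mn).
rewrite -raddfB; apply/(qp_norm_lt _ e0); exists N => m Nm.
by rewrite !cauchy_valE; apply: HN.
Qed.

Lemma qp_inv_ex x : exists y, x != 0 -> y * x = 1.
Proof.
have [->|[u [a [N [-> a0 _ HN]]]]] := qp_norm_cases x.
  by exists 0; rewrite eqxx.
have vC : (fun n => (u n)^-1) \in padic_cauchy p_pr.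
  apply/padic_cauchyP => e e0.
  have /padic_cauchyP/(_ (e * (a * a)))[|M HM] := valP u.
    by rewrite !mulr_gt0.
  exists (maxn N M) => m n; rewrite !geq_max => /andP[Nm Mm] /andP[Nn Mn].
  have um0 : u m != 0.
    by apply: contraTneq a0 => um; rewrite -(HN m) // um padic_abs0 ltxx.
  have un0 : u n != 0.
    by apply: contraTneq a0 => um; rewrite -(HN n) // um padic_abs0 ltxx.
  have aa : a * a = padic_abs p (u m * u n) by rewrite padic_absM // !HN.
  rewrite -(ltr_pM2r (mulr_gt0 a0 a0)) {1}aa -padic_absM //.
  have -> : ((u m)^-1 - (u n)^-1) * (u m * u n) = - (u m - u n).
    by field; rewrite um0 un0.
  by rewrite padic_absN; apply: HM.
exists (\pi_Qp (CauchySeq vC)) => _; apply/eqP; rewrite -subr_eq0.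
rewrite -rmorphM -(rmorph1 \pi_Qp) -raddfB qp_pi_eq0.
apply/padic_nullP => e e0; exists N => n Nn.
rewrite !cauchy_valE /= -[_ n]/((u n)^-1 * u n - 1) mulVf.
  by rewrite subrr padic_abs0.
by apply: contraTneq a0 => um; rewrite -(HN n) // um padic_abs0 ltxx.
Qed.

Definition qp_inv x : Qp :=
  if x == 0 then 0 else xget 0 [set y | y * x = 1]%classic.

Lemma qp_mulVf x : x != 0 -> qp_inv x * x = 1.
Proof.
move=> x0; rewrite /qp_inv (negPf x0); case: xgetP => [y _ //|H].
by have [y /(_ x0) Hy] := qp_inv_ex x; case: (H y).
Qed.

Lemma qp_inv0 : qp_inv 0 = 0. Proof. by rewrite /qp_inv eqxx. Qed.

HB.instance Definition _ := GRing.ComNzRing_isField.Build Qp qp_mulVf qp_inv0.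
End PadicNorm.

Section GroupRing.
Variable (G : groupType).
Local Open Scope fset_scope.
Local Open Scope ring_scope.

Definition group_ring : Type := {malg int[G]}.

HB.instance Definition _ := GRing.Zmodule.on group_ring.

Implicit Types f h : group_ring.

Definition gr_mul f h : group_ring :=
  \sum_(a <- msupp f) \sum_(b <- msupp h) << f@_a * h@_b *g (a * b)%g >>.

Lemma gr_mulw (A B : {fset G}) f h : msupp f `<=` A -> msupp h `<=` B ->
  gr_mul f h =
    \sum_(a <- A) \sum_(b <- B) << f@_a * h@_b *g (a * b)%g >>.
Proof.
move=> fA hB; rewrite /gr_mul (big_fset_incl _ fA) /=.
  apply: eq_bigr => a _; apply: big_fset_incl => // b _ /mcoeff_outdom ->.
  by rewrite mulr0 monalgU0.
move=> a _ /mcoeff_outdom fa.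
by rewrite big1 // => b _; rewrite fa mul0r monalgU0.
Qed.

Lemma gr_mulUU (c d : int) a b :
  gr_mul << c *g a >> << d *g b >> = << c * d *g (a * b)%g >>.
Proof. by rewrite (gr_mulw msuppU_le msuppU_le) !big_seq_fset1 !mcoeffUU. Qed.

Lemma gr_mulDl : left_distributive gr_mul +%R.
Proof.
move=> f1 f2 h; rewrite (gr_mulw (msuppD_le f1 f2) (fsubset_refl _)).
rewrite (gr_mulw (fsubsetUl (msupp f1) (msupp f2)) (fsubset_refl (msupp h))).
rewrite (gr_mulw (fsubsetUr (msupp f1) (msupp f2)) (fsubset_refl (msupp h))).
rewrite -big_split /=; apply: eq_bigr => a _.
rewrite -big_split /=; apply: eq_bigr => b _.
by rewrite mcoeffD mulrDl monalgUD.
Qed.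

Lemma gr_mulDr : right_distributive gr_mul +%R.
Proof.
move=> f h1 h2; rewrite (gr_mulw (fsubset_refl _) (msuppD_le h1 h2)).
rewrite (gr_mulw (fsubset_refl (msupp f)) (fsubsetUl (msupp h1) (msupp h2))).
rewrite (gr_mulw (fsubset_refl (msupp f)) (fsubsetUr (msupp h1) (msupp h2))).
rewrite -big_split /=; apply: eq_bigr => a _.
rewrite -big_split /=; apply: eq_bigr => b _.
by rewrite mcoeffD mulrDr monalgUD.
Qed.

Lemma gr_mul0l : left_zero 0 gr_mul.
Proof. by move=> h; rewrite /gr_mul msupp0 big_seq_fset0. Qed.

Lemma gr_mul0r : right_zero 0 gr_mul.
Proof.
by move=> f; rewrite /gr_mul big1 // => a _; rewrite msupp0 big_seq_fset0.
Qed.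

Lemma gr_mul1l : left_id << 1%g >> gr_mul.
Proof.
move=> f; rewrite (gr_mulw msuppU_le (fsubset_refl _)) big_seq_fset1.
rewrite [RHS]monalgE; apply: eq_bigr => a _.
by rewrite mcoeffUU mul1r mul1g.
Qed.

Lemma gr_mul1r : right_id << 1%g >> gr_mul.
Proof.
move=> f; rewrite (gr_mulw (fsubset_refl _) msuppU_le).
rewrite [RHS]monalgE; apply: eq_bigr => a _.
by rewrite big_seq_fset1 mcoeffUU mulr1 mulg1.
Qed.

Lemma gr_ind (P : group_ring -> Prop) :
  P 0 -> (forall f h, P f -> P h -> P (f + h)) ->
  (forall c a, P << c *g a >>) -> forall f, P f.
Proof.
by move=> P0 PD PU f; rewrite [f]monalgE; apply: big_ind.
Qed.

Lemma gr_mulA : associative gr_mul.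
Proof.
move=> f h k; elim/gr_ind: f => [|f1 f2 H1 H2|c a].
- by rewrite !gr_mul0l.
- by rewrite !gr_mulDl H1 H2.
elim/gr_ind: h => [|f1 f2 H1 H2|d b].
- by rewrite !(gr_mul0l, gr_mul0r).
- by rewrite !(gr_mulDl, gr_mulDr) H1 H2.
elim/gr_ind: k => [|f1 f2 H1 H2|e x].
- by rewrite !gr_mul0r.
- by rewrite !gr_mulDr H1 H2.
by rewrite !gr_mulUU mulrA mulgA.
Qed.

Lemma gr_one_neq0 : << 1%g >> != 0 :> group_ring.
Proof. by rewrite monalgU_eq0. Qed.

HB.instance Definition _ := GRing.Zmodule_isNzRing.Build group_ring
  gr_mulA gr_mul1l gr_mul1r gr_mulDl gr_mulDr gr_one_neq0.

Definition gr_elt (g : G) : group_ring := << g >>.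

Lemma gr_elt1 : gr_elt 1%g = 1. Proof. by []. Qed.

Lemma gr_eltM : {morph gr_elt : g h / (g * h)%g >-> g * h}.
Proof. by move=> g h; rewrite /GRing.mul /= gr_mulUU mulr1. Qed.

End GroupRing.

Section NullFamilies.
Variables (p : nat) (p_pr : prime p) (G : choiceType).
Local Notation Qp := (Qp p_pr).
Local Open Scope fset_scope.
Local Open Scope ring_scope.
Implicit Types (u v : G -> Qp).

Definition vanishing_at_infinity : {pred G -> Qp} := fun u =>
  `[< forall e : rat, 0 < e ->
        finite_set [set g | e <= qp_norm (u g)]%classic >].

Lemma vanishingP u : reflect
  (forall e : rat, 0 < e -> finite_set [set g | e <= qp_norm (u g)]%classic)
  (u \in vanishing_at_infinity).
Proof. exact: asboolP. Qed.

(* Unconditional summation of a family indexed by a discrete set. *)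
Definition qp_has_sum u (s : Qp) : Prop := forall e : rat, 0 < e ->
  exists F : {fset G}, forall F' : {fset G}, F `<=` F' ->
    qp_norm (\sum_(g <- F') u g - s) < e.

Definition qp_sum u : Qp := xget 0 [set s | qp_has_sum u s]%classic.

Lemma qp_has_sum_unique u s t : qp_has_sum u s -> qp_has_sum u t -> s = t.
Proof.
move=> hs ht; apply/eqP; rewrite -subr_eq0; apply/eqP.
apply: qp_eq0_small => e e0; have [A HA] := hs e e0; have [B HB] := ht e e0.
have -> : s - t = (\sum_(g <- A `|` B) u g - t) - (\sum_(g <- A `|` B) u g - s).
  by ring.
by apply: qp_normB_lt; [apply: HB; apply: fsubsetUr|apply: HA; apply: fsubsetUl].
Qed.

Lemma qp_sum_unique u s : qp_has_sum u s -> qp_sum u = s.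
Proof. by move=> hs; apply: xget_unique => // t /qp_has_sum_unique; apply. Qed.

Lemma big_fset_small u (A B : {fset G}) (e : rat) : 0 < e -> A `<=` B ->
  (forall g, g \notin A -> qp_norm (u g) < e) ->
  qp_norm (\sum_(g <- B) u g - \sum_(g <- A) u g) < e.
Proof.
move=> e0 AB H; rewrite (big_fsetID _ (mem A)) /=.
have -> : [fset x in B | x \in A] = A.
  apply/fsetP => x; rewrite !inE /=; have [xA|] := boolP (x \in A).
    by rewrite (fsubsetP AB).
  by rewrite andbF.
rewrite addrAC subrr add0r; apply: qp_norm_sum_lt => // g.
by rewrite !inE => /andP[_ /H].
Qed.

Lemma qp_has_sum_ex u : u \in vanishing_at_infinity ->
  exists s, qp_has_sum u s.
Proof.
move=> /vanishingP hu.
have inv0 n : 0 < n.+1%:R^-1 :> rat by rewrite invr_gt0 ltr0n.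
pose A n := fset_set [set g | n.+1%:R^-1 <= qp_norm (u g)]%classic.
have HA n g : g \notin A n -> qp_norm (u g) < n.+1%:R^-1.
  rewrite in_fset_set; last exact: hu.
  by rewrite notin_setE /= => /negP; rewrite -ltNge.
have small (e : rat) : 0 < e -> exists N, forall n, (N <= n)%N -> n.+1%:R^-1 < e.
  move=> e0; exists (Num.bound e^-1) => n Nn.
  rewrite -[e]invrK ltf_pV2 ?posrE ?invr_gt0 // ?ltr0n //.
  apply: lt_le_trans (_ : (Num.bound e^-1)%:R <= _).
    by apply: archi_boundP; rewrite invr_ge0 ltW.
  by rewrite ler_nat ltnW.
pose S n := \sum_(g <- A n) u g.
have HS (e : rat) n : 0 < e -> n.+1%:R^-1 < e -> forall B : {fset G}, A n `<=` B ->
    qp_norm (\sum_(g <- B) u g - S n) < e.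
  move=> e0 ne B AB; apply: big_fset_small => // g /HA /lt_trans; exact.
have [|L HL] := @qp_complete _ _ S.
  move=> e e0; have [N HN] := small e e0.
  exists N => m n /HN me /HN ne.
  have -> : S m - S n = (\sum_(g <- A m `|` A n) u g - S n)
                        - (\sum_(g <- A m `|` A n) u g - S m) by ring.
  by apply: qp_normB_lt; apply: HS => //; [apply: fsubsetUr|apply: fsubsetUl].
exists L => e e0; have [N HN] := small e e0; have [M HM] := HL e e0.
pose n := maxn N M; exists (A n) => B AB.
rewrite -[_ - L](subrKA (S n)); apply: qp_normD_lt.
  by apply: HS => //; apply: HN; apply: leq_maxl.
by apply: HM; apply: leq_maxr.
Qed.

Lemma qp_sumP u : u \in vanishing_at_infinity -> qp_has_sum u (qp_sum u).
Proof. by move=> /qp_has_sum_ex[s hs]; rewrite (qp_sum_unique hs). Qed.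

Lemma qp_sum_approx u (A : {fset G}) (e : rat) : u \in vanishing_at_infinity ->
  0 < e -> (forall g, g \notin A -> qp_norm (u g) < e) ->
  qp_norm (qp_sum u - \sum_(g <- A) u g) < e.
Proof.
move=> /qp_sumP hu e0 H; have [B HB] := hu e e0.
have -> : qp_sum u - \sum_(g <- A) u g =
    (\sum_(g <- A `|` B) u g - \sum_(g <- A) u g)
    - (\sum_(g <- A `|` B) u g - qp_sum u) by ring.
apply: qp_normB_lt; last by apply: HB; apply: fsubsetUr.
by apply: big_fset_small => //; apply: fsubsetUl.
Qed.

Lemma qp_sum_lt u (e : rat) : u \in vanishing_at_infinity -> 0 < e ->
  (forall g, qp_norm (u g) < e) -> qp_norm (qp_sum u) < e.
Proof.
move=> hu e0 H; have := @qp_sum_approx u fset0 e hu e0 (fun g _ => H g).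
by rewrite big_seq_fset0 subr0.
Qed.

Lemma qp_sum_finite u (A : {fset G}) : (forall g, g \notin A -> u g = 0) ->
  qp_sum u = \sum_(g <- A) u g.
Proof.
move=> H; apply: qp_sum_unique => e e0; exists A => B AB.
by apply: big_fset_small => // g /H ->; rewrite qp_norm0.
Qed.

Lemma vanishing_finite u (A : {fset G}) : (forall g, g \notin A -> u g = 0) ->
  u \in vanishing_at_infinity.
Proof.
move=> H; apply/vanishingP => e e0.
apply: sub_finite_set (finite_fset A) => g /= eg.
by apply: contraLR eg => /H ->; rewrite qp_norm0 -ltNge.
Qed.

Lemma vanishing_zmod_closed : zmod_closed vanishing_at_infinity.
Proof.
split; first exact: (@vanishing_finite _ fset0).
move=> u v /vanishingP hu /vanishingP hv; apply/vanishingP => e e0.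
have : finite_set ([set g | e <= qp_norm (u g)] `|` [set g | e <= qp_norm (v g)])%classic.
  by rewrite finite_setU; split; [exact: hu|exact: hv].
apply: sub_finite_set => g /= h.
apply/orP; apply: contraLR h; rewrite negb_or -!ltNge => /andP[].
exact: qp_normB_lt.
Qed.

HB.instance Definition _ := GRing.isZmodClosed.Build (G -> Qp)
  vanishing_at_infinity vanishing_zmod_closed.

Lemma qp_sumD u v : u \in vanishing_at_infinity -> v \in vanishing_at_infinity ->
  qp_sum (fun g => u g + v g) = qp_sum u + qp_sum v.
Proof.
move=> /qp_sumP hu /qp_sumP hv; apply: qp_sum_unique => e e0.
have [A HA] := hu e e0; have [B HB] := hv e e0.
exists (A `|` B) => F ABF; rewrite big_split /= opprD addrACA.
by apply: qp_normD_lt; [apply: HA|apply: HB]; apply: fsubset_trans ABF;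
  [apply: fsubsetUl|apply: fsubsetUr].
Qed.

Lemma vanishing_bounded u : u \in vanishing_at_infinity ->
  exists2 C : rat, 0 < C & forall g, qp_norm (u g) < C.
Proof.
move=> /vanishingP/(_ 1 ltr01) fin.
pose A := fset_set [set g | 1 <= qp_norm (u g)]%classic.
pose C := 1 + \sum_(g <- A) qp_norm (u g).
have C1 : 1 <= C by rewrite lerDl sumr_ge0 // => g _; exact: qp_norm_ge0.
exists C => [|g]; first exact: lt_le_trans C1.
have [gA|] := boolP (g \in A).
  rewrite /C (big_fsetD1 g) //= addrCA ltrDl ltr_pwDl // sumr_ge0 // => h _.
  exact: qp_norm_ge0.
rewrite in_fset_set // notin_setE /= => /negP; rewrite -ltNge => h.
exact: lt_le_trans C1.
Qed.

End NullFamilies.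

Section C0.
Variables (p : nat) (p_pr : prime p) (G : groupType).
Local Notation Qp := (Qp p_pr).
Local Open Scope fset_scope.
Local Open Scope ring_scope.

Record c0 := C0 {
  c0_val :> G -> Qp; _ : c0_val \in @vanishing_at_infinity p p_pr G }.

HB.instance Definition _ := [isSub for c0_val].
HB.instance Definition _ := [Choice of c0 by <:].
HB.instance Definition _ := [SubChoice_isSubZmodule of c0 by <:].

Implicit Types (x y z : c0) (f h : group_ring G).

Lemma c0P x y : (forall g, x g = y g) -> x = y.
Proof. by move=> H; apply: val_inj; apply/funext. Qed.

Lemma c0_val0 g : (0 : c0) g = 0. Proof. by []. Qed.
Lemma c0_valN x g : (- x) g = - x g. Proof. by []. Qed.
Lemma c0_valD x y g : (x + y) g = x g + y g. Proof. by []. Qed.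

(* The convolution at g sums x a * y b over all pairs with a * b = g. *)
Definition conv_term x y (g a : G) : Qp := x a * y (a^-1 * g)%g.

Lemma c0_bounded x : exists2 C : rat, 0 < C & forall g, qp_norm (x g) < C.
Proof. exact: vanishing_bounded (valP x). Qed.

Lemma conv_term_vanishing x y g :
  conv_term x y g \in @vanishing_at_infinity p p_pr G.
Proof.
have [C C0 HC] := c0_bounded y; apply/vanishingP => e e0.
have /vanishingP/(_ (e / C) (divr_gt0 e0 C0)) := valP x.
apply: sub_finite_set => a /=; apply: contraLR; rewrite -!ltNge => h.
rewrite /conv_term qp_normM -[e](divfK (lt0r_neq0 C0)).
by apply: ltr_pM; rewrite ?qp_norm_ge0.
Qed.

Definition conv x y : G -> Qp := fun g => qp_sum (conv_term x y g).

Lemma conv_vanishing x y : conv x y \in @vanishing_at_infinity p p_pr G.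
Proof.
have [A A0 HA] := c0_bounded x; have [B B0 HB] := c0_bounded y.
apply/vanishingP => e e0.
have /vanishingP/(_ _ (divr_gt0 e0 B0)) fx := valP x.
have /vanishingP/(_ _ (divr_gt0 e0 A0)) fy := valP y.
apply: sub_finite_set (finite_image2 (fun a b => (a * b)%g) fx fy) => g /= eg.
apply: contrapT => Hg; move: eg; apply/negP; rewrite -ltNge.
apply: qp_sum_lt => // [|a]; first exact: conv_term_vanishing.
rewrite /conv_term qp_normM.
have [xa|xa] := ltP (qp_norm (x a)) (e / B).
  rewrite -[e](divfK (lt0r_neq0 B0)).
  by apply: ltr_pM; rewrite ?qp_norm_ge0.
have [yb|yb] := ltP (qp_norm (y (a^-1 * g)%g)) (e / A).
  rewrite mulrC -[e](divfK (lt0r_neq0 A0)).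
  by apply: ltr_pM; rewrite ?qp_norm_ge0.
by case: Hg; exists a => //; exists (a^-1 * g)%g => //; rewrite mulVKg.
Qed.

Definition c0_mul x y : c0 := C0 (conv_vanishing x y).

Lemma c0_mulE x y g : c0_mul x y g = qp_sum (conv_term x y g).
Proof. by []. Qed.

Lemma c0_mul_lt x y (A B : rat) g : 0 < A -> 0 < B ->
  (forall g, qp_norm (x g) < A) -> (forall g, qp_norm (y g) < B) ->
  qp_norm (c0_mul x y g) < A * B.
Proof.
move=> A0 B0 HA HB; apply: qp_sum_lt => [||a]; first exact: conv_term_vanishing.
  exact: mulr_gt0.
by rewrite /conv_term qp_normM; apply: ltr_pM; rewrite ?qp_norm_ge0.
Qed.

Lemma c0_mulDl : left_distributive c0_mul +%R.
Proof.
move=> x y z; apply: c0P => g; rewrite c0_valD !c0_mulE -qp_sumD;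
  try exact: conv_term_vanishing.
by congr qp_sum; apply/funext => a; rewrite /conv_term c0_valD mulrDl.
Qed.

Lemma c0_mulDr : right_distributive c0_mul +%R.
Proof.
move=> x y z; apply: c0P => g; rewrite c0_valD !c0_mulE -qp_sumD;
  try exact: conv_term_vanishing.
by congr qp_sum; apply/funext => a; rewrite /conv_term c0_valD mulrDr.
Qed.

Lemma c0_mul0l : left_zero 0 c0_mul.
Proof. by move=> x; apply: (addrI (c0_mul 0 x)); rewrite -c0_mulDl !addr0. Qed.

Lemma c0_mul0r : right_zero 0 c0_mul.
Proof. by move=> x; apply: (addrI (c0_mul x 0)); rewrite -c0_mulDr !addr0. Qed.

Lemma c0_mono_subproof (c : Qp) (a : G) :
  (fun g => if g == a then c else 0) \in @vanishing_at_infinity p p_pr G.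
Proof.
by apply: (@vanishing_finite _ _ _ _ [fset a]) => g; rewrite inE => /negPf ->.
Qed.

Definition c0_mono (c : Qp) (a : G) : c0 := C0 (c0_mono_subproof c a).

Lemma c0_monoE c a g : c0_mono c a g = if g == a then c else 0.
Proof. by []. Qed.

Lemma c0_mono_mul c a x g : c0_mul (c0_mono c a) x g = c * x (a^-1 * g)%g.
Proof.
rewrite c0_mulE (@qp_sum_finite _ _ _ _ [fset a]) => [|b].
  by rewrite big_seq_fset1 /conv_term c0_monoE eqxx.
by rewrite inE /conv_term c0_monoE => /negPf ->; rewrite mul0r.
Qed.

Lemma c0_mul_mono c a x g : c0_mul x (c0_mono c a) g = x (g * a^-1)%g * c.
Proof.
rewrite c0_mulE (@qp_sum_finite _ _ _ _ [fset (g * a^-1)%g]) => [|b].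
  rewrite big_seq_fset1 /conv_term c0_monoE invgM invgK -mulgA mulVg mulg1.
  by rewrite eqxx.
rewrite inE /conv_term c0_monoE => bN; case: eqP => [ba|]; last by rewrite mulr0.
by case/eqP: bN; rewrite -ba invgM invgK mulVKg.
Qed.

Lemma c0_mono0 a : c0_mono 0 a = 0.
Proof. by apply: c0P => g; rewrite c0_monoE if_same. Qed.

Lemma c0_sumE (I : Type) (r : seq I) (F : I -> c0) g :
  (\sum_(i <- r) F i) g = \sum_(i <- r) F i g.
Proof. by elim/big_rec2: _ => // i u y _ <-. Qed.

Lemma c0_trunc x (e : rat) : 0 < e -> exists A : {fset G},
  forall g, qp_norm ((x - \sum_(a <- A) c0_mono (x a) a) g) < e.
Proof.
move=> e0; have /vanishingP/(_ e e0) fx := valP x.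
exists (fset_set [set g | e <= qp_norm (x g)]%classic) => g.
rewrite c0_valD c0_valN c0_sumE; set A := fset_set _.
have [gA|gA] := boolP (g \in A).
  rewrite (big_fsetD1 g) //= eqxx big1_fset ?addr0 ?subrr ?qp_norm0 // => a.
  by rewrite !inE eq_sym => /andP[/negPf -> _].
rewrite big1_fset => [|a aA _].
  by rewrite subr0 ltNge; move: gA; rewrite in_fset_set // notin_setE /= => /negP.
by rewrite c0_monoE; case: eqP aA gA => // -> ->.
Qed.

Lemma c0_mulNl x y : c0_mul (- x) y = - c0_mul x y.
Proof.
by apply: (addrI (c0_mul x y)); rewrite -c0_mulDl !subrr c0_mul0l.
Qed.
Lemma c0_mulNr x y : c0_mul x (- y) = - c0_mul x y.
Proof.
by apply: (addrI (c0_mul x y)); rewrite -c0_mulDr !subrr c0_mul0r.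
Qed.

Let assoc x y z := c0_mul x (c0_mul y z) - c0_mul (c0_mul x y) z.

Let assocDl x x' y z : assoc (x + x') y z = assoc x y z + assoc x' y z.
Proof. by rewrite /assoc !c0_mulDl opprD addrACA. Qed.

Let assocDr x y z z' : assoc x y (z + z') = assoc x y z + assoc x y z'.
Proof. by rewrite /assoc !c0_mulDr opprD addrACA. Qed.

Let assoc_lt x y z (A B C : rat) g : 0 < A -> 0 < B -> 0 < C ->
  (forall g, qp_norm (x g) < A) -> (forall g, qp_norm (y g) < B) ->
  (forall g, qp_norm (z g) < C) -> qp_norm (assoc x y z g) < A * B * C.
Proof.
move=> A0 B0 C0 HA HB HC; rewrite /assoc c0_valD c0_valN.
apply: qp_normB_lt; last first.
  by apply: c0_mul_lt; rewrite ?mulr_gt0 // => h; apply: c0_mul_lt.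
rewrite -mulrA; apply: c0_mul_lt; rewrite ?mulr_gt0 // => h.
exact: c0_mul_lt.
Qed.

Let assoc_mono c a y d b : assoc (c0_mono c a) y (c0_mono d b) = 0.
Proof.
apply/eqP; rewrite subr_eq0; apply/eqP; apply: c0P => g.
rewrite (c0_mono_mul c a (c0_mul y (c0_mono d b)) g) (c0_mul_mono d b y).
rewrite (c0_mul_mono d b (c0_mul (c0_mono c a) y) g) (c0_mono_mul c a y).
by rewrite mulgA mulrA.
Qed.

Let assoc0l y z : assoc 0 y z = 0.
Proof. by rewrite /assoc !c0_mul0l subrr. Qed.
Let assoc0r x y : assoc x y 0 = 0.
Proof. by rewrite /assoc !c0_mul0r subrr. Qed.

Let assoc_sum (r s : seq G) (F H : G -> Qp) y :
  assoc (\sum_(a <- r) c0_mono (F a) a) y (\sum_(a <- s) c0_mono (H a) a) = 0.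
Proof.
apply: (big_ind (fun u => assoc u y _ = 0)) => [|u v Hu Hv|a _].
- exact: assoc0l.
- by rewrite assocDl Hu Hv addr0.
apply: (big_ind (fun u => assoc _ y u = 0)) => [|u v Hu Hv|b _].
- exact: assoc0r.
- by rewrite assocDr Hu Hv addr0.
exact: assoc_mono.
Qed.

Lemma c0_mulA : associative c0_mul.
Proof.
move=> x y z; apply: c0P => g; apply/eqP; rewrite -subr_eq0; apply/eqP.
apply: qp_eq0_small => e e0.
rewrite -[X in qp_norm X]/(assoc x y z g).
have [A A0 HA] := c0_bounded x; have [B B0 HB] := c0_bounded y.
have [C C0 HC] := c0_bounded z.
have d10 : 0 < e / (B * C) by rewrite divr_gt0 // mulr_gt0.
have [P HP] := c0_trunc x d10; set x' := \sum_(a <- P) _ in HP.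
have [D D0 HD] := c0_bounded x'.
have d20 : 0 < e / (D * B) by rewrite divr_gt0 // mulr_gt0.
have [Q HQ] := c0_trunc z d20; set z' := \sum_(a <- Q) _ in HQ.
have -> : assoc x y z = assoc (x - x') y z + assoc x' y (z - z').
  have zE : assoc x' y z = assoc x' y (z - z').
    by have := assocDr x' y (z - z') z'; rewrite assoc_sum subrK addr0.
  by have := assocDl (x - x') x' y z; rewrite subrK -zE.
rewrite c0_valD; apply: qp_normD_lt.
  have -> : e = e / (B * C) * B * C.
    by rewrite -mulrA divfK // mulf_neq0 ?lt0r_neq0.
  exact: assoc_lt.
have -> : e = D * B * (e / (D * B)).
  by rewrite mulrC divfK // mulf_neq0 ?lt0r_neq0.
exact: assoc_lt.
Qed.

Definition c0_one : c0 := c0_mono 1 1%g.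

Lemma c0_mul1l : left_id c0_one c0_mul.
Proof. by move=> x; apply: c0P => g; rewrite c0_mono_mul mul1r invg1 mul1g. Qed.

Lemma c0_mul1r : right_id c0_one c0_mul.
Proof. by move=> x; apply: c0P => g; rewrite c0_mul_mono mulr1 invg1 mulg1. Qed.

Lemma c0_one_neq0 : c0_one != 0.
Proof.
apply/eqP => /(congr1 (fun x : c0 => x 1%g)); rewrite c0_monoE eqxx c0_val0.
by apply/eqP; rewrite oner_eq0.
Qed.

HB.instance Definition _ := GRing.Zmodule_isNzRing.Build c0
  c0_mulA c0_mul1l c0_mul1r c0_mulDl c0_mulDr c0_one_neq0.

Definition c0_unit : {pred c0} := fun x => `[< exists y, y * x = 1 /\ x * y = 1 >].

Definition c0_inv x : c0 :=
  if x \in c0_unit then xget 0 [set y | y * x = 1 /\ x * y = 1]%classic else x.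

Lemma c0_invP x : x \in c0_unit -> c0_inv x * x = 1 /\ x * c0_inv x = 1.
Proof.
move=> xU; rewrite /c0_inv xU; case: xgetP => [y _ //|H].
by case/asboolP: xU => y /H.
Qed.

Lemma c0_mulVr : {in c0_unit, left_inverse 1 c0_inv *%R}.
Proof. by move=> x /c0_invP[]. Qed.

Lemma c0_mulrV : {in c0_unit, right_inverse 1 c0_inv *%R}.
Proof. by move=> x /c0_invP[]. Qed.

Lemma c0_unitrP x y : y * x = 1 /\ x * y = 1 -> x \in c0_unit.
Proof. by move=> H; apply/asboolP; exists y. Qed.

Lemma c0_inv_out : {in [predC c0_unit], c0_inv =1 id}.
Proof. by move=> x; rewrite inE /c0_inv => /negPf ->. Qed.

HB.instance Definition _ := GRing.NzRing_hasMulInverse.Build c0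
  c0_mulVr c0_mulrV c0_unitrP c0_inv_out.

Lemma c0_of_gr_subproof f :
  (fun g => (f@_g)%:~R) \in @vanishing_at_infinity p p_pr G.
Proof.
by apply: (@vanishing_finite _ _ _ _ (msupp f)) => g /mcoeff_outdom ->.
Qed.

Definition c0_of_gr f : c0 := C0 (c0_of_gr_subproof f).

Lemma c0_of_grE f g : c0_of_gr f g = (f@_g)%:~R. Proof. by []. Qed.

Lemma c0_of_gr_zmod : zmod_morphism c0_of_gr.
Proof.
move=> f h; apply: c0P => g.
by rewrite c0_valD c0_valN !c0_of_grE mcoeffB rmorphB.
Qed.

HB.instance Definition _ := GRing.isZmodMorphism.Build
  (group_ring G) c0 c0_of_gr c0_of_gr_zmod.

Lemma c0_of_grU c a : c0_of_gr << c *g a >> = c0_mono c%:~R a.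
Proof.
apply: c0P => g; rewrite c0_of_grE c0_monoE mcoeffU eq_sym.
by case: eqP; rewrite ?mulr1n ?mulr0n.
Qed.

Lemma c0_of_gr_monoid : monoid_morphism c0_of_gr.
Proof.
split=> [|f h]; first exact: c0_of_grU.
elim/gr_ind: f => [|f1 f2 H1 H2|c a].
- by rewrite mul0r raddf0 mul0r.
- by rewrite mulrDl !raddfD /= H1 H2 mulrDl.
elim/gr_ind: h => [|f1 f2 H1 H2|d b].
- by rewrite mulr0 raddf0 mulr0.
- by rewrite mulrDr !raddfD /= H1 H2 mulrDr.
have -> : (<< c *g a >> : group_ring G) * << d *g b >> =
    << c * d *g (a * b)%g >> by exact: gr_mulUU.
rewrite !c0_of_grU rmorphM; apply: c0P => g.
rewrite [RHS](c0_mono_mul c%:~R a (c0_mono d%:~R b) g) !c0_monoE.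
rewrite -(inj_eq (mulgI a) (a^-1 * g)%g b) mulVKg; case: eqP; by rewrite ?mulr0.
Qed.

HB.instance Definition _ := GRing.isMonoidMorphism.Build
  (group_ring G) c0 c0_of_gr c0_of_gr_monoid.

Lemma c0_of_gr_inj : injective c0_of_gr.
Proof.
move=> f h /(congr1 (fun x : c0 => c0_val x)) E; apply/malgP => g.
apply/eqP; rewrite -subr_eq0; apply: contraT => n0.
have := padic_abs_neq0 p_pr (_ : (f@_g - h@_g)%:~R != 0 :> rat).
rewrite intr_eq0 => /(_ n0); rewrite -(qp_norm_const p_pr).
rewrite -[X in qp_norm X]/(qp_of_rat p_pr _) rmorph_int.
suff -> : (f@_g - h@_g)%:~R = 0 :> Qp by rewrite qp_norm0 ltxx.
rewrite rmorphB; apply/eqP; rewrite subr_eq0; apply/eqP.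
exact: (congr1 (fun u : G -> Qp => u g) E).
Qed.

(* Right multiplication makes c0 a right module over the group ring, i.e. a
   left module over its converse ring. *)
Definition c0_rscale (a : (group_ring G)^c) x : c0 :=
  x * c0_of_gr (a : group_ring G).

Lemma c0_rscaleA (a b : (group_ring G)^c) x :
  c0_rscale a (c0_rscale b x) = c0_rscale (a * b) x.
Proof.
rewrite /c0_rscale -mulrA -rmorphM; congr (_ * _).
Qed.

Lemma c0_rscale1 : left_id 1 c0_rscale.
Proof. by move=> x; rewrite /c0_rscale rmorph1 mulr1. Qed.

Lemma c0_rscaleDr : right_distributive c0_rscale +%R.
Proof. by move=> a x y; rewrite /c0_rscale mulrDl. Qed.

Lemma c0_rscaleDl x : {morph c0_rscale^~ x : a b / a + b}.
Proof. by move=> a b; rewrite /c0_rscale raddfD mulrDr. Qed.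

HB.instance Definition _ := GRing.Zmodule_isLmodule.Build (group_ring G)^c c0
  c0_rscaleA c0_rscale1 c0_rscaleDr c0_rscaleDl.

End C0.

Section CyclicModule.
Variables (A : nzRingType) (f : A).
Local Open Scope quotient_scope.

Definition left_ideal : {pred A} := fun h => `[< exists a, h = a * f >].

Lemma left_ideal_zmod_closed : zmod_closed left_ideal.
Proof.
split; first by apply/asboolP; exists 0; rewrite mul0r.
move=> _ _ /asboolP[a ->] /asboolP[b ->].
by apply/asboolP; exists (a - b); rewrite mulrBl.
Qed.

HB.instance Definition _ :=
  GRing.isZmodClosed.Build A left_ideal left_ideal_zmod_closed.

Definition cyclic_module : Type := {ideal_quot left_ideal}.

HB.instance Definition _ := GRing.Zmodule.on cyclic_module.
HB.instance Definition _ := ZmodQuotient.on cyclic_module.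

Definition cyclic_scale (a : A) (m : cyclic_module) : cyclic_module :=
  \pi_cyclic_module (a * repr m).

Lemma cyclic_pi_eq (x y : A) :
  (\pi_cyclic_module x == \pi_cyclic_module y) = (x - y \in left_ideal).
Proof. by rewrite piE Quotient.equivE. Qed.

Lemma cyclic_pi_surj m : exists x, m = \pi_cyclic_module x.
Proof. by exists (repr m); rewrite reprK. Qed.

Lemma cyclic_scale_pi a (x : A) :
  cyclic_scale a (\pi_cyclic_module x) = \pi_cyclic_module (a * x).
Proof.
apply/eqP; rewrite cyclic_pi_eq -mulrBr.
have : repr (\pi_cyclic_module x) - x \in left_ideal.
  by rewrite -cyclic_pi_eq reprK.
by move=> /asboolP[b ->]; apply/asboolP; exists (a * b); rewrite mulrA.
Qed.

Lemma cyclic_scaleA a b m :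
  cyclic_scale a (cyclic_scale b m) = cyclic_scale (a * b) m.
Proof. by have [x ->] := cyclic_pi_surj m; rewrite !cyclic_scale_pi mulrA. Qed.

Lemma cyclic_scale1 : left_id 1 cyclic_scale.
Proof. by move=> m; have [x ->] := cyclic_pi_surj m; rewrite cyclic_scale_pi mul1r. Qed.

Lemma cyclic_scaleDr : right_distributive cyclic_scale +%R.
Proof.
move=> a m n; have [x ->] := cyclic_pi_surj m; have [y ->] := cyclic_pi_surj n.
rewrite -raddfD !cyclic_scale_pi.
by rewrite mulrDr raddfD.
Qed.

Lemma cyclic_scaleDl m : {morph cyclic_scale^~ m : a b / a + b}.
Proof.
move=> a b; have [x ->] := cyclic_pi_surj m.
by rewrite !cyclic_scale_pi mulrDl raddfD.
Qed.

HB.instance Definition _ := GRing.Zmodule_isLmodule.Build A cyclic_module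
  cyclic_scaleA cyclic_scale1 cyclic_scaleDr cyclic_scaleDl.

End CyclicModule.

Section Tensor.
Variables (A : nzRingType) (M : lmodType A^c) (N : lmodType A).
Local Notation free := {malg int[(M * N)%type]}.

(* A right A-module is a left module over the converse ring A^c, so that
   (a : A^c) *: m stands for the right action of a on m. *)
Inductive tensor_relator : free -> Prop :=
| TensorAddl m m' n :
    tensor_relator (<< (m + m', n) >> - << (m, n) >> - << (m', n) >>)
| TensorAddr m n n' :
    tensor_relator (<< (m, n + n') >> - << (m, n) >> - << (m, n') >>)
| TensorBal m (a : A) n :
    tensor_relator (<< ((a : A^c) *: m, n) >> - << (m, a *: n) >>).

(* The subgroup generated by the relators. *)
Definition tensor_ker : {pred free} := fun x =>
  `[< forall H : {pred free}, zmod_closed H ->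
        (forall y, tensor_relator y -> y \in H) -> x \in H >].

Lemma tensor_ker_zmod_closed : zmod_closed tensor_ker.
Proof.
split; first by apply/asboolP => H [].
move=> x y /asboolP hx /asboolP hy; apply/asboolP => H Hz Hr.
by apply: Hz.2; [apply: hx|apply: hy].
Qed.

HB.instance Definition _ :=
  GRing.isZmodClosed.Build free tensor_ker tensor_ker_zmod_closed.

Definition tensor : Type := {ideal_quot tensor_ker}.

HB.instance Definition _ := GRing.Zmodule.on tensor.
HB.instance Definition _ := ZmodQuotient.on tensor.

Definition tens (m : M) (n : N) : tensor := (\pi_tensor << (m, n) >>)%qT.

Lemma tensor_pi_relator x : tensor_relator x -> (\pi_tensor x = 0)%qT.
Proof.
move=> hx; apply/eqP; rewrite piE Quotient.equivE subr0.
by apply/asboolP => H _; apply.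
Qed.

Lemma tensDl m m' n : tens (m + m') n = tens m n + tens m' n.
Proof.
have /eqP := tensor_pi_relator (TensorAddl m m' n).
by rewrite !raddfB /= subr_eq add0r subr_eq => /eqP E; rewrite /tens E addrC.
Qed.

Lemma tensDr m n n' : tens m (n + n') = tens m n + tens m n'.
Proof.
have /eqP := tensor_pi_relator (TensorAddr m n n').
by rewrite !raddfB /= subr_eq add0r subr_eq => /eqP E; rewrite /tens E addrC.
Qed.

Lemma tens_balanced m (a : A) n : tens ((a : A^c) *: m) n = tens m (a *: n).
Proof.
have /eqP := tensor_pi_relator (TensorBal m a n).
by rewrite raddfB /= subr_eq0 => /eqP.
Qed.

End Tensor.

Section Dual.
Variables (R : realType).

Definition integers : {pred R} := fun t => t \is a Num.int.

Lemma integers_zmod_closed : zmod_closed integers.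
Proof. by split=> [|s t]; [exact: rpred0|exact: rpredB]. Qed.

HB.instance Definition _ :=
  GRing.isZmodClosed.Build R integers integers_zmod_closed.

Definition circle : Type := {ideal_quot integers}.

HB.instance Definition _ := GRing.Zmodule.on circle.
HB.instance Definition _ := ZmodQuotient.on circle.

Variable V : zmodType.

Definition additive_maps : {pred V -> circle} := fun x => `[< zmod_morphism x >].

Lemma additive_maps_zmod_closed : zmod_closed additive_maps.
Proof.
split; first by apply/asboolP => u v; exact: (esym (subrr 0)).
move=> x y /asboolP hx /asboolP hy; apply/asboolP => u v.
rewrite -[LHS]/(x (u - v) - y (u - v)) -[RHS]/(x u - y u - (x v - y v)).
by rewrite hx hy !opprD !opprK -!addrA; congr (_ + _); rewrite addrCA.
Qed.

HB.instance Definition _ := GRing.isZmodClosed.Build (V -> circle)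
  additive_maps additive_maps_zmod_closed.

(* V is discrete, so continuity of characters is automatic. *)
Record pontryagin_dual :=
  PontryaginDual { dual_val :> V -> circle; _ : dual_val \in additive_maps }.

HB.instance Definition _ := [isSub for dual_val].
HB.instance Definition _ := [Choice of pontryagin_dual by <:].
HB.instance Definition _ := [SubChoice_isSubZmodule of pontryagin_dual by <:].

End Dual.

Section DualAction.
Variables (R : realType) (G : groupType) (V : lmodType (group_ring G)).
Local Notation X := (pontryagin_dual R V).

Lemma dual_act_subproof (g : G) (x : X) :
  (fun m => x (gr_elt g^-1%g *: m)) \in @additive_maps R V.
Proof.
have /asboolP hx := valP x.
by apply/asboolP => u v; rewrite scalerBr hx.
Qed.

(* If x g denotes the value of x at the class of gr_elt g in cyclic_module f,
   then dual_act g x is the family g' |-> x (g^-1 * g')%g. *)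
Definition dual_act (g : G) (x : X) : X :=
  PontryaginDual (dual_act_subproof g x).

Definition dual_fix (N : {pred G}) : set X :=
  [set x | forall g, g \in N -> dual_act g x = x]%classic.
End DualAction.

Definition bounded_torsion (p : nat) (X : zmodType) : Prop :=
  exists i0 : nat, forall i, (i0 <= i)%N ->
    [set x : X | x *+ (p ^ i) = 0]%classic = [set x : X | x *+ (p ^ i0) = 0]%classic.

Section Subgroups.
Variable G : groupType.

Definition normal_subgroup (N : {pred G}) : Prop :=
  group_closed N /\ forall x y : G, x \in N -> (x ^ y)%g \in N.

Definition finite_index (N : {pred G}) : Prop :=
  finite_set (range (fun g : G => [set (g * n)%g | n in [set` N]]))%classic.

Definition residually_finite : Prop :=
  exists Gam : nat -> {pred G},
    (forall n, normal_subgroup (Gam n) /\ finite_index (Gam n)) /\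
    forall g : G, (forall n, g \in Gam n) -> g = 1%g.
End Subgroups.

(* Main.v *)
From HB Require Import structures.
Require Import Defs.
From mathcomp Require Import all_boot all_order all_algebra.
From mathcomp Require Import finmap monalg.
From mathcomp Require Import all_classical all_reals.
From mathcomp Require Import zify.

(** Write A for the integral group ring of G, M for A / A f and X for the dual
of M. All the conditions are compared with one congruence in A:
there are i, a, h with h f = p^i (1 - p a).

Bounded torsion. A character of M is killed by p^i exactly when it vanishes on
p^i M. As characters separate the points outside p^i M from p^i M
([character_separation]), the increasing chain of p^i-torsion subgroups of X
stabilises if and only if the decreasing chain p^i M does, that is if and only
if p^i lies in p^(i+1) A + A f for some i, which is the congruence
([bounded_torsion_congruence], [congruence_bounded_torsion]).

Left inverses. Given the congruence, the geometric series inverts 1 - p a in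
c0, which is complete ([c0_complete]), and (1 - p a)^-1 p^-i h is a left inverse
of f ([c0_left_inverse_ex]). Conversely, if g f = 1 then p^i g has integral
coefficients for some i; an approximation h of p^i g in A makes p^i - h f an
element of A with small coefficients, hence divisible by a high power of p
([c0_left_inverse_approx]). The congruence then even holds modulo p^k for every
k, with the same i, and h is close to p^i g.

Tensor product. The module M is generated by the class of 1, which f kills,
while a left inverse of f puts every element of c0 in c0 f; so the tensor
product vanishes. Conversely the multiplication map from the tensor
product to c0 / c0 f sends 1 tensor 1 to the class of 1.

Finite quotients. Right multiplication on the right cosets of a subgroup N of
finite index is a ring morphism from A to integer matrices ([coset_rep]). It turns the
congruence into H F = p^i (1 - p B) with integer matrices, and the determinant
of 1 - p B is 1 modulo p. A character of M fixed by N is given by its values at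
the finitely many cosets. The matrix H F kills this vector of values, hence so
does its nonzero determinant, and only finitely many points of the circle are
killed by a given nonzero integer ([finite_dual_fix]).

Right inverses. One-sided inverses of square matrices are two-sided; in the
form needed here, H F = p^i (1 - p^(l+1) B) implies F H = p^i modulo p^(l+1)
([mulmx_swap_mod]). If G is residually finite, every coefficient of an element
of A is an entry of one of its matrices, so f h = p^i modulo p^(l+1) in A. When
l grows, h tends to p^i g, and f g = 1 follows ([c0_right_inverse]). *)

Set Implicit Arguments.
Unset Strict Implicit.
Unset Printing Implicit Defensive.

Import Order.TTheory GRing.Theory Num.Theory.

Local Open Scope ring_scope.
Local Open Scope classical_set_scope.

(** * Integer matrices congruent to a scalar matrix *)

Section IntegerMatrices.
Variables (p : nat) (p_pr : prime p) (d : nat).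
Implicit Types A F H : 'M[int]_d.

(** Reduction modulo p turns the matrix into the identity. *)
Lemma det_one_sub_coprime A : coprimez p (\det (1%:M - p%:Z *: A)).
Proof.
have p0 : p%:R = 0 :> 'F_p by apply: pcharf0; exact: pchar_Fp.
rewrite coprimezE /= prime_coprime //; apply/negP => pD.
have := oner_neq0 'F_p; case/eqP.
have <- : (\det (1%:M - p%:Z *: A))%:~R = 1 :> 'F_p.
  rewrite -[LHS]/(intr _) -det_map_mx map_mxB map_mx1 /= map_mxZ /=.
  by rewrite -[p%:~R]/(p%:R) p0 scale0r subr0 det1.
rewrite [X in X%:~R]intEsign rmorphM /=; case/dvdnP: pD => k ->.
by rewrite PoszM rmorphM /= -[p%:~R]/(p%:R) p0 !mulr0.
Qed.

(** Over the fraction field this says that a left inverse of a square matrix is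
a right inverse; cancelling by the determinant of F avoids leaving the
integers. *)
Lemma mulmx_swap_scalar F H (c : int) : c != 0 ->
  H *m F = c%:M -> F *m H = c%:M.
Proof.
move=> c0 HF.
have [d0|d_gt0] := posnP d.
  by apply/matrixP => i; have := ltn_ord i; rewrite {2}d0.
have F0 : \det F != 0.
  apply/eqP => F0; have := congr1 determinant HF.
  rewrite det_mulmx F0 mulr0 det_scalar => /esym/eqP; rewrite expf_eq0.
  by rewrite (negPf c0) andbF.
have E : \det F *: H = c *: \adj F.
  by rewrite -mul_mx_scalar -mul_mx_adj mulmxA HF mul_scalar_mx.
have : \det F *: (F *m H) = \det F *: c%:M.
  by rewrite scalemxAr E -scalemxAr mul_mx_adj !scale_scalar_mx mulrC.
move=> /matrixP E2; apply/matrixP => i j; have := E2 i j.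
by rewrite [LHS]mxE [RHS]mxE; apply: mulfI.
Qed.

(** If 1 - p^(l+1) A had an inverse over the integers, F H would be equal to q
plus a multiple of p^(l+1), by moving F around the product. Only its
adjugate is available, but the determinant that this introduces is prime to
p and can be cancelled in a divisibility by a power of p. *)
Lemma mulmx_swap_mod A F H (q : int) (l : nat) : q != 0 ->
  H *m F = q *: (1%:M - (p ^ l.+1)%:Z *: A) ->
  forall i j, ((p ^ l.+1)%:Z %| (F *m H - q%:M) i j)%Z.
Proof.
move=> q0 HF i j.
set C := 1%:M - _ *: A in HF; pose D := \det C.
have cop : coprimez p D.
  by rewrite /D /C expnS PoszM -scalerA det_one_sub_coprime.
have D0 : D != 0.
  apply: contraTneq cop => ->; rewrite coprimezE /coprime gcdn0 /=.
  by rewrite neq_ltn prime_gt1 ?orbT.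
have FCH : F *m (\adj C *m H) = (q * D)%:M.
  apply: mulmx_swap_scalar; first by rewrite mulf_neq0.
  by rewrite -mulmxA HF -scalemxAr mul_adj_mx scale_scalar_mx.
pose X := \adj C *m A.
have adjE : \adj C = D%:M + (p ^ l.+1)%:Z *: X.
  by rewrite -mul_adj_mx [in RHS]/C mulmxBr mulmx1 -scalemxAr subrK.
have DE : D *: (F *m H - q%:M) = - ((p ^ l.+1)%:Z *: (F *m (X *m H))).
  apply/eqP; rewrite scalerBr subr_eq -subr_eq0 opprD opprK addrA; move/eqP: FCH.
  rewrite adjE mulmxDl mulmxDr mul_scalar_mx -!scalemxAl -!scalemxAr.
  by rewrite scale_scalar_mx [D * q]mulrC -subr_eq0.
have : ((p ^ l.+1)%:Z %| D * (F *m H - q%:M) i j)%Z.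
  have /matrixP/(_ i j) := DE; rewrite [LHS]mxE => ->.
  by rewrite mxE mxE rpredN dvdz_mulr.
by rewrite Gauss_dvdzr // coprimezE /= coprimeXl.
Qed.

End IntegerMatrices.

(** Multiply the vector v by the adjugate of B. *)
Lemma mulmx_torsion (V : zmodType) d (B : 'M[int]_d) (v : 'I_d -> V) :
  (forall i, \sum_j v j *~ B i j = 0) -> forall k, v k *~ \det B = 0.
Proof.
move=> Bv k; transitivity (\sum_j v j *~ (\adj B *m B) k j).
  rewrite mul_adj_mx (bigD1 k) //= mxE eqxx mulr1n big1 ?addr0 // => j jk.
  by rewrite mxE eq_sym (negPf jk) mulr0n mulr0z.
under eq_bigr => j _ do rewrite mxE mulrz_sumr.
rewrite exchange_big big1 // => i _.
under eq_bigr => j _ do rewrite mulrC mulrzA.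
by rewrite -mulrz_suml Bv mul0rz.
Qed.

(** * Characters of abelian groups *)

Section Circle.
Variable R : realType.
Local Open Scope quotient_scope.
Implicit Types t s : circle R.

Lemma circle_pi_eq0 (a : R) : (\pi_(circle R) a == 0 :> circle R) = (a \is a Num.int).
Proof. by rewrite -(raddf0 \pi_(circle R)) piE Quotient.equivE subr0. Qed.

Lemma circle_divisible n t : (0 < n)%N -> exists s, s *+ n = t.
Proof.
move=> n0; exists (\pi_(circle R) (repr t / n%:R)).
rewrite -raddfMn /= -(mulr_natr (_ / _)) divfK ?reprK //.
by rewrite pnatr_eq0 -lt0n.
Qed.

Lemma circle_torsionP n t : (0 < n)%N -> t *+ n = 0 ->
  exists k : 'I_n, t = \pi_(circle R) (k%:R / n%:R).
Proof.
move=> n0; have nR : n%:R != 0 :> R by rewrite pnatr_eq0 -lt0n.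
have nZ : n%:Z != 0 by rewrite eqz_nat -lt0n.
rewrite -[t]reprK -raddfMn => /eqP; rewrite circle_pi_eq0 => /intrP[z zE].
have kn : (`|(z %% n)%Z| < n)%N.
  by rewrite -ltz_nat gez0_abs ?modz_ge0 // ltz_pmod.
exists (Ordinal kn); apply/eqP; rewrite -subr_eq0 -raddfB circle_pi_eq0.
apply/intrP; exists (z %/ n)%Z; apply: (mulIf nR).
rewrite mulrBl divfK // mulr_natr zE /= {1}(divz_eq z n).
rewrite -[X in _ - X]/((Posz `|(z %% n)%Z|)%:~R) gez0_abs ?modz_ge0 //.
by rewrite rmorphD rmorphM /= addrK.
Qed.

Lemma circle_torsion_ex n : (1 < n)%N -> exists2 t : circle R, t != 0 & t *+ n = 0.
Proof.
move=> n1; have n0 : n%:R != 0 :> R by rewrite pnatr_eq0 -lt0n ltnW.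
exists (\pi_(circle R) (n%:R^-1)).
  rewrite circle_pi_eq0; apply/negP => /intrP[z zE].
  have : z * n = 1.
    by apply: (@intr_inj R); rewrite rmorphM /= -zE mulVf.
  by move/(congr1 absz); rewrite abszM /= => /eqP; rewrite muln_eq1; lia.
by rewrite -raddfMn -(mulr_natr _^-1) mulVf //; apply/eqP; rewrite circle_pi_eq0 rpred1.
Qed.

End Circle.

Section DualAdditive.
Variables (R : realType) (V : zmodType) (x : pontryagin_dual R V).

Lemma dual_val_zmod_morphism : zmod_morphism (dual_val x).
Proof. by have /asboolP := valP x. Qed.

HB.instance Definition _ := GRing.isZmodMorphism.Build V (circle R) (dual_val x)
  dual_val_zmod_morphism.

End DualAdditive.

Lemma dual_mulrn (R : realType) (V : zmodType) (x : pontryagin_dual R V) n v :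
  (x *+ n) v = x (v *+ n).
Proof.
rewrite raddfMn; elim: n => [|n IH]; first by rewrite !mulr0n.
by rewrite !mulrS -IH.
Qed.

Lemma dual_eqP (R : realType) (V : zmodType) (x y : pontryagin_dual R V) :
  (forall v, x v = y v) -> x = y.
Proof. by move=> xy; apply: val_inj; apply/funext. Qed.

Lemma last_outside (P : nat -> Prop) k : ~ P 0%N -> P k ->
  exists j, ~ P j /\ P j.+1.
Proof.
move=> P0; elim: k => // k IH Pk.
by have [/IH//|nPk] := pselect (P k); exists k.
Qed.

Section CharacterExtension.
Variables (R : realType) (V : zmodType) (p : nat) (p_pr : prime p).
Implicit Types (Gam : set (V * circle R)) (v : V) (t s : circle R).

(** A character defined on a subgroup of V, given by its graph, the empty graph
being allowed: the second clause forces the values to be unique, so that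
such graphs can be united along chains. *)
Definition character_graph Gam :=
  (forall x y, Gam x -> Gam y -> Gam (x - y)) /\
  (forall t, Gam (0, t) -> t = 0).

Lemma pair_mulrn v t n : (v, t) *+ n = (v *+ n, t *+ n).
Proof. by rewrite [LHS]surjective_pairing (raddfMn fst) (raddfMn snd). Qed.

Lemma character_graphD Gam x y : character_graph Gam ->
  Gam x -> Gam y -> Gam (x + y).
Proof.
move=> gG gx gy; have G0 : Gam 0 by rewrite -(subrr y); apply: gG.1.
have := gG.1 _ _ gx (gG.1 _ _ G0 gy).
by rewrite sub0r opprK.
Qed.

Lemma character_graphMz Gam x (n : int) : character_graph Gam ->
  Gam x -> Gam (x *~ n).
Proof.
move=> gG gx; have G0 : Gam 0 by rewrite -(subrr x); apply: gG.1.
have Gn k : Gam (x *+ k).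
  by elim: k => [|k IH]; rewrite ?mulr0n // mulrS; apply: character_graphD.
case: n => k; first exact: Gn.
by rewrite NegzE mulrNz -[- _]add0r; apply: gG.1 => //; apply: Gn.
Qed.

Lemma character_graph_inj Gam v t s : character_graph Gam ->
  Gam (v, t) -> Gam (v, s) -> t = s.
Proof.
move=> [GB G0] gt gs; apply/eqP; rewrite -subr_eq0; apply/eqP/G0.
by have := GB _ _ gt gs; rewrite -[_ - _]/(v - v, t - s) subrr.
Qed.

(** A character extends from a subgroup W to W + Z v when p v lies in W, by any
choice of a p-th part s of its value at p v. This is consistent because p is
prime: if v is not in W, the multiples of v in W are the multiples of p v. *)
Lemma character_graph_step Gam v t s : character_graph Gam ->
  Gam (v *+ p, t) -> s *+ p = t -> (forall t', ~ Gam (v, t')) ->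
  exists Gam', [/\ character_graph Gam', Gam `<=` Gam' & Gam' (v, s)].
Proof.
move=> gG gt st vN; pose vs : V * circle R := (v, s).
exists [set x | exists n : int, Gam (x - vs *~ n)]; split=> /=; last 2 first.
- by move=> x gx; exists 0; rewrite mulr0z subr0.
- exists 1; rewrite mulr1z subrr -(subrr (v *+ p, t)); exact: gG.1.
have gp : Gam (vs *~ p%:Z) by rewrite -pmulrn pair_mulrn st.
split=> [x y [n gx] [m gy]|u [n gn]].
  exists (n - m); rewrite mulrzBr; have := gG.1 _ _ gx gy.
  by rewrite !opprD !opprK !addrA; congr Gam; rewrite -!addrA; congr (_ + _); rewrite addrCA.
have [/dvdzP[n' nE]|pn] := boolP (p%:Z %| n)%Z.
  apply: gG.2; have := character_graphD gG gn (character_graphMz n' gG gp).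
  by rewrite -mulrzA mulrC -nE subrK.
have [a [b]] := Bezoutz n p%:Z; have -> : gcdz n p = 1.
  apply/eqP; rewrite -[_ == 1]/(coprimez n p) coprimez_sym coprimezE.
  by rewrite prime_coprime.
move=> ab.
(* As a n + b p = 1, this combination of points of the graph lies above v. *)
pose z := (v *+ p, t) *~ b - ((0, u) - vs *~ n) *~ a.
have z1 : z.1 = v.
  rewrite (raddfB fst) (raddfMz fst) (raddfMz fst) (raddfB fst) (raddfMz fst) /=.
  rewrite sub0r mulNrz opprK -mulrzA pmulrn -mulrzA -mulrzDr.
  by rewrite addrC [n * a]mulrC [_ * b]mulrC ab mulr1z.
case: (vN z.2); rewrite -{1}z1 -surjective_pairing.
by apply: gG.1; apply: character_graphMz.
Qed.

(** The circle is divisible, so a character of a subgroup extends to V. When p^k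
V lies in the subgroup, a proper maximal extension could always be enlarged
by an element v outside its domain with p v inside. *)
Lemma character_graph_total Gam k : character_graph Gam -> Gam 0 ->
  (forall v, exists t, Gam (v *+ p ^ k, t)) ->
  exists2 x : V -> circle R, zmod_morphism x & forall v t, Gam (v, t) -> x v = t.
Proof.
move=> gG G0 Gk.
(* The second clause keeps the empty set, the union of the empty chain, among
   the admissible sets. *)
pose P Gam' := character_graph Gam' /\ (Gam' !=set0 -> Gam `<=` Gam').
have [|M [[gM MG] Mmax]] := @Zorn_bigcup (V * circle R)%type P.
  move=> F FP Ftot; split; last first.
    move=> [x [X FX Xx]]; apply: (subset_trans ((FP X FX).2 _)); first by exists x.
    exact: bigcup_sup.
  split=> [x y [X FX Xx] [Y FY Yy]|t [X FX]]; last exact: (FP X FX).1.2.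
  have [XY|YX] := Ftot _ _ FX FY.
    by exists Y => //; apply: (FP Y FY).1.1 => //; apply: XY.
  by exists X => //; apply: (FP X FX).1.1 => //; apply: YX.
have GM : Gam `<=` M.
  have [M0|/set0P/MG//] := eqVneq M set0.
  case: (Mmax Gam); last by split=> // _; exact: subset_refl.
  by rewrite M0; split; [exact: sub0set|move=> /(_ _ G0)].
have dom v : exists t, M (v, t).
  apply: contrapT => /forallNP vN.
  have [||j [wN [t wt]]] := @last_outside (fun j => exists t, M (v *+ p ^ j, t)) k.
  - by rewrite expn0 mulr1n => -[t /vN].
  - by have [t /GM] := Gk v; exists t.
  have [s st] := circle_divisible t (prime_gt0 p_pr).
  rewrite expnSr mulrnA in wt.
  have [|M' [gM' MM' M's]] := character_graph_step gM wt st.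
    by move=> t' wt'; apply: wN; exists t'.
  case: (Mmax M'); last by split=> // _; apply: subset_trans MM'.
  by split=> // /(_ _ M's) ws; apply: wN; exists s.
have [x xM] := choice dom.
exists x => [u v|v t /GM vt]; last exact: character_graph_inj (xM v) vt.
exact: character_graph_inj (gM) (xM _) (gM.1 _ _ (xM u) (xM v)).
Qed.

(** Some multiple m p^j of m is the last one outside W. The zero character on W
extends to it with a nonzero value killed by p, and then to V. *)
Lemma character_separation (W : set V) k m :
  W 0 -> (forall x y, W x -> W y -> W (x - y)) ->
  (forall v, W (v *+ p ^ k)) -> ~ W m ->
  exists2 x : pontryagin_dual R V, (forall w, W w -> x w = 0) & x m != 0.
Proof.
move=> W0 WB Wk Wm; pose Gam : set (V * circle R) := [set x | W x.1 /\ x.2 = 0].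
have gG : character_graph Gam.
  split=> [[u s] [v t] /= [Wu /= ->] [Wv /= ->]|t [_ //]].
  by split=> /=; [exact: WB|rewrite subrr].
have [||j [wN Ww]] := @last_outside (fun j => W (m *+ p ^ j)) k.
- by rewrite expn0 mulr1n.
- exact: Wk.
have [s s0 sp] := circle_torsion_ex R (prime_gt1 p_pr).
rewrite expnSr mulrnA in Ww.
have [||Gam' [gG' GG' G's]] := @character_graph_step Gam (m *+ p ^ j) 0 s gG _ sp.
- by split.
- by move=> t [].
have [||x xadd xG] := character_graph_total (k := k) gG'.
- by apply: GG'; split.
- by move=> v; exists 0; apply: GG'; split; first exact: Wk.
have xA : x \in @additive_maps R V by apply/asboolP.
exists (PontryaginDual xA) => [w Ww'|]; first by apply/xG/GG'; split.
apply: contraNneq s0 => xm0; rewrite -(xG _ _ G's).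
apply/eqP; apply: etrans (raddfMn (dual_val (PontryaginDual xA)) (p ^ j) m) _ => /=.
by rewrite [x m]xm0 mul0rn.
Qed.

End CharacterExtension.

(** * Bounded torsion and congruences in the group ring *)

Section BoundedTorsion.
Variables (R : realType) (p : nat) (p_pr : prime p).
Local Open Scope quotient_scope.

Variables (A : nzRingType) (f : A).
Local Notation M := (cyclic_module f).
Local Notation X := (pontryagin_dual R M).

(** If p^i were not in p^(i+1) A + A f, some character of M would vanish on
p^(i+1) M but not at the class of p^i; it would be killed by p^(i+1) and not
by p^i. *)
Lemma bounded_torsion_congruence : bounded_torsion p X ->
  exists i (a h : A), h * f = 1 *+ p ^ i - a *+ p ^ i.+1.
Proof.
move=> [i Hi]; exists i.
pose W := [set m : M | exists v, m = v *+ p ^ i.+1].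
have [[m mE]|mW] := pselect (W (\pi_M 1 *+ p ^ i)).
  have [a aE] := cyclic_pi_surj m; move/eqP: mE.
  rewrite aE -!raddfMn cyclic_pi_eq => /asboolP[h hE].
  by exists a, h.
have [|||x xW] := @character_separation R M p p_pr W i.+1 (\pi_M 1 *+ p ^ i) _ _ _ mW.
- by exists 0; rewrite mul0rn.
- by move=> _ _ [u ->] [v ->]; exists (u - v); rewrite mulrnBl.
- by move=> v; exists v.
rewrite -dual_mulrn; suff -> : x *+ p ^ i = 0 by rewrite eqxx.
have /seteqP[+ _] := Hi i.+1 (leqnSn i); apply.
apply: dual_eqP => v; rewrite dual_mulrn.
by apply: xW; exists v.
Qed.

(** The congruence gives p^i M = p^(i+1) M, hence p^i M = p^j M for all j >= i. *)
Lemma congruence_bounded_torsion i (a h : A) :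
  h * f = 1 *+ p ^ i - a *+ p ^ i.+1 -> bounded_torsion p X.
Proof.
move=> hf; exists i => j ij; apply/seteqP; split=> x /= xj; last first.
  by rewrite -(subnK ij) addnC expnD mulrnA xj mul0rn.
have step (m : M) : exists m', m *+ p ^ i = m' *+ p ^ i.+1.
  have [b ->] := cyclic_pi_surj m; exists (\pi_M (b * a)).
  rewrite -!raddfMn; apply/eqP; rewrite cyclic_pi_eq; apply/asboolP.
  by exists (b * h); rewrite -mulrA hf mulrBr !mulrnAr mulr1.
have div (m : M) k : exists m', m *+ p ^ i = m' *+ p ^ (i + k).
  elim: k => [|k [m' ->]]; first by exists m; rewrite addn0.
  rewrite expnD mulrnA; have [m'' ->] := step m'.
  by exists m''; rewrite -mulrnA -expnD addSnnS.
apply: dual_eqP => m; rewrite dual_mulrn.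
have [m' ->] := div m (j - i)%N.
by rewrite subnKC // -dual_mulrn xj.
Qed.

End BoundedTorsion.

(** * Integers in the p-adic numbers *)

Section PadicIntegers.
Variables (p : nat) (p_pr : prime p).
Local Notation Qp := (Qp p_pr).
Local Open Scope quotient_scope.

Let p_gt0 : 0 < p%:R :> rat. Proof. by rewrite ltr0n prime_gt0. Qed.
Let p_gt1 : 1 < p%:R :> rat. Proof. by rewrite ltr1n prime_gt1. Qed.

Lemma pexpN_gt0 k : 0 < p%:R ^- k :> rat.
Proof. by rewrite invr_gt0 exprn_gt0. Qed.

Lemma pexpN_small (e : rat) : 0 < e ->
  exists N, forall n, (N <= n)%N -> p%:R ^- n < e.
Proof.
move=> e0; exists (Num.bound e^-1) => n Nn.
rewrite -[e]invrK ltf_pV2 ?posrE ?invr_gt0 ?exprn_gt0 //.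
apply: lt_le_trans (_ : (Num.bound e^-1)%:R <= _).
  by apply: archi_boundP; rewrite invr_ge0 ltW.
by rewrite -natrX ler_nat (leq_trans Nn) // ltnW // ltn_expl // prime_gt1.
Qed.

Lemma padic_abs_int (n : int) : n != 0 ->
  padic_abs p n%:~R = p%:R ^- logn p `|n|.
Proof.
move=> n0; rewrite -[n%:~R]divr1 -[1]/(1%:~R) padic_abs_frac //.
by rewrite logn1 sub0r -exprnN.
Qed.

Lemma padic_abs_int_le1 (n : int) : padic_abs p n%:~R <= 1.
Proof.
have [->|n0] := eqVneq n 0; first by rewrite padic_abs0.
by rewrite padic_abs_int // invf_le1 ?exprn_gt0 // exprn_ege1 // ltW.
Qed.

Lemma padic_abs_int_lt (n : int) k :
  (padic_abs p n%:~R < p%:R ^- k) = ((p ^ k.+1)%:Z %| n)%Z.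
Proof.
have [->|n0] := eqVneq n 0; first by rewrite padic_abs0 pexpN_gt0 dvdz0.
rewrite padic_abs_int // ltf_pV2 ?posrE ?exprn_gt0 // ltr_eXn2l //.
by rewrite dvdzE /= pfactor_dvdn // absz_gt0.
Qed.

Lemma padic_abs_int_coprime (n : int) : ~~ (p %| `|n|)%N -> padic_abs p n%:~R = 1.
Proof.
move=> pn; have n0 : n != 0 by apply: contraNneq pn => ->; rewrite dvdn0.
by rewrite padic_abs_int // lognE (negPf pn) !andbF expr0 invr1.
Qed.

(** The denominator of q is prime to p, hence invertible modulo p^(k+1). *)
Lemma padic_int_approx (q : rat) k : padic_abs p q <= 1 ->
  exists n : int, padic_abs p (q - n%:~R) < p%:R ^- k.
Proof.
move=> q1; have den0 : (denq q)%:~R != 0 :> rat by rewrite intr_eq0 denq_neq0.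
have pden : ~~ (p %| `|denq q|)%N.
  apply/negP => pd; move: q1; rewrite leNgt => /negP; apply.
  have pn : ~~ (p %| `|numq q|)%N.
    apply/negP => pn; have : (p %| gcdn `|numq q| `|denq q|)%N.
      by rewrite dvdn_gcd pn.
    by rewrite (eqP (coprime_num_den q)) dvdn1 => /eqP p1; move: p_pr; rewrite p1.
  have d1 : padic_abs p (denq q)%:~R < 1.
    by have := padic_abs_int_lt (denq q) 0; rewrite expn1 dvdzE /= pd expr0 invr1.
  have := padic_abs_int_coprime pn; rewrite numqE padic_absM // => nE.
  by rewrite -nE gtr_pMr // padic_abs_neq0 //; apply: contraNneq pn => ->; rewrite dvdn0.
have [u [v uv]] := Bezoutz (denq q) (p ^ k.+1)%:Z.
have {}uv : u * denq q = 1 - v * (p ^ k.+1)%:Z.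
  apply/eqP; rewrite eq_sym subr_eq eq_sym uv.
  by rewrite -[_ == 1]/(coprimez _ _) coprimezE coprime_sym coprimeXl // prime_coprime.
exists (numq q * u).
suff : padic_abs p ((q - (numq q * u)%:~R) * (denq q)%:~R) < p%:R ^- k.
  by rewrite padic_absM // (padic_abs_int_coprime pden) mulr1.
rewrite mulrBl -numqE -intrM -intrB padic_abs_int_lt -mulrA uv.
by rewrite mulrBr mulr1 opprB addrC subrK mulrA dvdz_mull.
Qed.

Lemma qp_norm_int (n : int) : qp_norm (n%:~R : Qp) = padic_abs p n%:~R.
Proof. by rewrite -qp_norm_const -[\pi _]/(qp_of_rat p_pr _) rmorph_int. Qed.

Lemma qp_int_approx (z : Qp) k : qp_norm z <= 1 ->
  exists n : int, qp_norm (z - n%:~R) < p%:R ^- k.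
Proof.
move=> z1; have [q zq] := qp_dense z (pexpN_gt0 k).
have e1 : p%:R ^- k <= 1 :> rat by rewrite invf_le1 ?exprn_gt0 // exprn_ege1 // ltW.
have q1 : padic_abs p q <= 1.
  rewrite -(qp_norm_const p_pr) leNgt; apply/negP => q1.
  have := qp_normB_lt (le_lt_trans z1 q1) (lt_trans (lt_le_trans zq e1) q1).
  by rewrite subKr ltxx.
have [n qn] := padic_int_approx k q1; exists n.
rewrite -[z](subrK (qp_of_rat p_pr q)) -addrA; apply: qp_normD_lt => //.
by rewrite -(rmorph_int (qp_of_rat p_pr)) -rmorphB qp_norm_const.
Qed.

Lemma qp_norm_mulpn (z : Qp) k : qp_norm (z *+ p ^ k) = qp_norm z * p%:R ^- k.
Proof.
rewrite -(mulr_natr z) qp_normM natrX; congr (_ * _).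
elim: k => [|k IH]; first by rewrite expr0 qp_norm1 invr1.
rewrite exprS qp_normM IH -[p%:R]/(p%:~R) qp_norm_int padic_abs_int //.
  by rewrite /= logn_prime // eqxx -invfM -exprS.
by rewrite eqz_nat -lt0n prime_gt0.
Qed.

End PadicIntegers.

(** * Approximation and completeness in the algebra of null families *)

Lemma gr_divisible_ex (G : groupType) (u : group_ring G) (n : nat) :
  (forall g, (n%:Z %| u@_g)%Z) -> exists a, u = a *+ n.
Proof.
move=> nu; exists [malg g in msupp u => (u@_g %/ n)%Z]; apply/malgP => g.
rewrite mcoeffMn mcoeffE; case: ifPn => [_|/mcoeff_outdom ->].
  by rewrite -mulr_natr natz divzK.
by rewrite mul0rn.
Qed.

Section C0Norm.
Variables (p : nat) (p_pr : prime p) (G : groupType).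
Local Notation Qp := (Qp p_pr).
Local Notation c0 := (c0 p_pr G).
Local Notation c0_of_gr := (@c0_of_gr p p_pr G).
Implicit Types (x y : c0) (e : rat) (f a h u : group_ring G).

(** As the maximum of the norms of the coefficients is attained, this says that
the sup norm of x is less than e. *)
Definition c0_lt x e := forall g, qp_norm (x g) < e.

Lemma c0_ltD x y e : c0_lt x e -> c0_lt y e -> c0_lt (x + y) e.
Proof. by move=> xe ye g; rewrite c0_valD qp_normD_lt. Qed.

Lemma c0_ltN x e : c0_lt x e -> c0_lt (- x) e.
Proof. by move=> xe g; rewrite c0_valN qp_normN. Qed.

Lemma c0_ltB x y e : c0_lt x e -> c0_lt y e -> c0_lt (x - y) e.
Proof. by move=> xe ye; apply: c0_ltD => //; apply: c0_ltN. Qed.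

Lemma c0_lt0 e : 0 < e -> c0_lt 0 e.
Proof. by move=> e0 g; rewrite c0_val0 qp_norm0. Qed.

Lemma c0_lt_le x e e' : e <= e' -> c0_lt x e -> c0_lt x e'.
Proof. by move=> ee xe g; exact: lt_le_trans (xe g) ee. Qed.

Lemma c0_lt_eq0 x : (forall e, 0 < e -> c0_lt x e) -> x = 0.
Proof. by move=> xe; apply: c0P => g; apply: qp_eq0_small => e /xe. Qed.

Lemma c0_mulrnE x n g : (x *+ n) g = x g *+ n.
Proof. by elim: n => // n IH; rewrite !mulrS c0_valD IH. Qed.

Lemma c0_lt_mulpn x k e : c0_lt x e -> c0_lt (x *+ p ^ k) (e * p%:R ^- k).
Proof.
by move=> xe g; rewrite c0_mulrnE qp_norm_mulpn ltr_pM2r ?pexpN_gt0.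
Qed.

(** Integers have p-adic norm at most 1. *)
Lemma c0_lt_mul_gr x f e : 0 < e -> c0_lt x e -> c0_lt (x * c0_of_gr f) e.
Proof.
move=> e0 xe; elim/gr_ind: f => [|f1 f2 H1 H2|c a].
- by rewrite raddf0 mulr0; apply: c0_lt0.
- by rewrite (raddfD c0_of_gr) /=; rewrite mulrDr; exact: c0_ltD H1 H2.
move=> g; rewrite c0_of_grU (c0_mul_mono _ _ x) qp_normM qp_norm_int.
by rewrite (le_lt_trans _ (xe (g * a^-1)%g)) // ler_piMr ?qp_norm_ge0 ?padic_abs_int_le1.
Qed.

Lemma c0_lt_gr_mul x f e : 0 < e -> c0_lt x e -> c0_lt (c0_of_gr f * x) e.
Proof.
move=> e0 xe; elim/gr_ind: f => [|f1 f2 H1 H2|c a].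
- by rewrite raddf0 mul0r; apply: c0_lt0.
- by rewrite (raddfD c0_of_gr) /=; rewrite mulrDl; exact: c0_ltD H1 H2.
move=> g; rewrite c0_of_grU (c0_mono_mul _ _ x) qp_normM qp_norm_int.
by rewrite (le_lt_trans _ (xe (a^-1 * g)%g)) // ler_piMl ?qp_norm_ge0 ?padic_abs_int_le1.
Qed.

Lemma c0_lt_gr u k : c0_lt (c0_of_gr u) (p%:R ^- k) <->
  exists a, u = a *+ p ^ k.+1.
Proof.
split=> [uk|[a ->] g].
  by apply: gr_divisible_ex => g; rewrite -padic_abs_int_lt // -(qp_norm_int p_pr) -c0_of_grE.
by rewrite c0_of_grE qp_norm_int padic_abs_int_lt // mcoeffMn -mulr_natr natz dvdz_mull.
Qed.

(** Only finitely many coefficients of x are not already small; those are p-adic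
integers and integers are dense among them. *)
Lemma c0_gr_approx x k : (forall g, qp_norm (x g) <= 1) ->
  exists h, c0_lt (x - c0_of_gr h) (p%:R ^- k).
Proof.
move=> x1; have /vanishingP/(_ _ (pexpN_gt0 p_pr k)) fin := valP x.
have [n nx] := choice (fun g => qp_int_approx k (x1 g)).
pose A := fset_set [set g | p%:R ^- k <= qp_norm (x g)].
exists [malg g in A => n g] => g.
rewrite c0_valD c0_valN c0_of_grE mcoeffE; case: ifPn => // gA.
rewrite subr0 ltNge; apply/negP => kx; move/negP: gA; apply.
by rewrite in_fset_set // inE.
Qed.

Lemma c0_mulpn_integral x : exists i, forall g, qp_norm ((x *+ p ^ i) g) <= 1.
Proof.
have [C C0 xC] := c0_bounded x.
have CV : 0 < C^-1 by rewrite invr_gt0.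
have [i /(_ i (leqnn i)) iC] := pexpN_small p_pr CV.
exists i => g; rewrite c0_mulrnE qp_norm_mulpn.
apply: (@le_trans _ _ (C * C^-1)); last by rewrite divff ?lt0r_neq0.
by apply: ler_pM; rewrite ?qp_norm_ge0 ?ltW ?pexpN_gt0 ?xC.
Qed.

(** With h close to p^i x, the element p^i - h f of the group ring is close to
(p^i x) f - h f, so its coefficients are small, which for integers means
divisible by a power of p. The exponent i depends on x only, while k is
arbitrary; this is what allows passing to the limit later. *)
Lemma c0_left_inverse_approx x f : x * c0_of_gr f = 1 ->
  exists i, forall k, exists h a, h * f = 1 *+ p ^ i - a *+ p ^ k.+1 /\
    c0_lt (x *+ p ^ i - c0_of_gr h) (p%:R ^- k).
Proof.
move=> xf; have [i xi] := c0_mulpn_integral x; exists i => k.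
have [h hx] := c0_gr_approx k xi.
have [] := (c0_lt_gr (1 *+ p ^ i - h * f) k).1; last first.
  by move=> a aE; exists h, a; split=> //; rewrite -aE subKr.
have := c0_lt_mul_gr f (pexpN_gt0 p_pr k) hx.
suff -> : (x *+ p ^ i - c0_of_gr h) * c0_of_gr f = c0_of_gr (1 *+ p ^ i - h * f) by [].
by rewrite mulrBl mulrnAl xf rmorphB rmorphMn rmorph1 rmorphM.
Qed.

(** Coefficients converge because Q_p is complete. The limit tends to zero at
infinity since it is uniformly close to a term of the sequence. *)
Lemma c0_complete (s : nat -> c0) :
  (forall e, 0 < e -> exists N, forall m n,
     (N <= m)%N -> (N <= n)%N -> c0_lt (s m - s n) e) ->
  exists x, forall e, 0 < e -> exists N, forall n, (N <= n)%N -> c0_lt (s n - x) e.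
Proof.
move=> sC.
have [|L sL] := choice (fun g => @qp_complete p p_pr (fun n => s n g) _) => [g|].
  move=> e /sC[N HN]; exists N => m n Nm Nn; exact: HN.
have close e : 0 < e -> exists N, forall n, (N <= n)%N ->
    forall g, qp_norm (s n g - L g) < e.
  move=> e0; have [N HN] := sC e e0; exists N => n Nn g.
  have [M HM] := sL g e e0; pose m := maxn N M.
  rewrite -[s n g](subrK (s m g)) -addrA; apply: qp_normD_lt.
    by apply: HN => //; apply: leq_maxl.
  by apply: HM; apply: leq_maxr.
have Lv : L \in @vanishing_at_infinity p p_pr G.
  apply/vanishingP => e e0; have [N /(_ N (leqnn N)) HN] := close e e0.
  have /vanishingP/(_ e e0) := valP (s N); apply: sub_finite_set => g /= eL.
  rewrite leNgt; apply/negP => sN; have := qp_normB_lt sN (HN g).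
  by rewrite subKr ltNge eL.
by exists (C0 Lv).
Qed.

End C0Norm.

(** * Left inverses and the tensor product *)

Lemma sum_expr_mul1B (A : nzRingType) (w : A) n :
  (\sum_(j < n) w ^+ j) * (1 - w) = 1 - w ^+ n.
Proof.
elim: n => [|n IH]; first by rewrite big_ord0 mul0r expr0 subrr.
by rewrite big_ord_recr /= mulrDl IH mulrBr mulr1 -exprSr addrA subrK.
Qed.

Section LeftInverse.
Variables (p : nat) (p_pr : prime p) (G : groupType).
Local Notation c0 := (c0 p_pr G).
Local Notation c0_of_gr := (@c0_of_gr p p_pr G).
Implicit Types (x y : c0) (f a h : group_ring G).

(** With b = p^-i h one has b f = 1 - p a, so the partial sums of the geometric
series of p a, multiplied by b, converge to a left inverse. *)
Lemma c0_left_inverse_ex f i a h : h * f = 1 *+ p ^ i - a *+ p ^ i.+1 ->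
  exists x : c0, x * c0_of_gr f = 1.
Proof.
move=> hf; pose F := c0_of_gr f; pose w := c0_of_gr a *+ p.
pose y : c0 := c0_mono (p%:R ^- i) 1%g; pose b := y * c0_of_gr h.
have y1 : y *+ p ^ i = 1.
  have p0 : p%:R ^+ i != 0 :> Qp p_pr.
    rewrite expf_neq0 // -qp_norm_eq0 -[p%:R]/(p%:~R) qp_norm_int gt_eqF //.
    by rewrite padic_abs_neq0 // intr_eq0 eqz_nat -lt0n prime_gt0.
  apply: c0P => g; rewrite c0_mulrnE !c0_monoE; case: ifP => _; last exact: mul0rn.
  by rewrite -(mulr_natr _^-1) natrX mulVf.
have bF : b * F = 1 - w.
  rewrite -mulrA -rmorphM hf rmorphB !rmorphMn rmorph1 expnS mulrnA -mulrnBl /=.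
  by rewrite mulrnAr -mulrnAl y1 mul1r.
have wn n : w ^+ n = c0_of_gr (a ^+ n) *+ p ^ n.
  by rewrite exprMn_n rmorphXn.
pose s n := (\sum_(j < n) w ^+ j) * b.
have sF n : s n * F = 1 - w ^+ n by rewrite -mulrA bF sum_expr_mul1B.
have [C C0 bC] := c0_bounded b.
have wbC j : c0_lt (w ^+ j * b) (C * p%:R ^- j).
  by rewrite wn mulrnAl; apply: c0_lt_mulpn; apply: c0_lt_gr_mul.
have small e : 0 < e -> exists N, forall n, (N <= n)%N -> C * p%:R ^- n < e.
  move=> e0; have [N HN] := pexpN_small p_pr (divr_gt0 e0 C0).
  by exists N => n /HN; rewrite ltr_pdivlMr // mulrC.
have tail (e : rat) N : (forall n, (N <= n)%N -> C * p%:R ^- n < e) ->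
    0 < e -> forall k, c0_lt (s (N + k)%N - s N) e.
  move=> HN e0; elim=> [|k IH]; first by rewrite addn0 subrr; apply: c0_lt0.
  rewrite addnS /s big_ord_recr /= mulrDl addrAC; apply: c0_ltD => //.
  exact: c0_lt_le (ltW (HN _ (leq_addr _ _))) (wbC _).
have [e e0|x sx] := @c0_complete _ p_pr _ s.
  have [N HN] := small e e0; exists N => m n Nm Nn.
  rewrite -(subnKC Nm) -(subnKC Nn) -(subrKA (s N)) -[s N - _]opprB.
  by apply: c0_ltB; apply: tail.
exists x; apply/eqP; rewrite -subr_eq0; apply/eqP; apply: c0_lt_eq0 => e e0.
have [N HN] := sx e e0; have [M HM] := pexpN_small p_pr e0.
pose n := (maxn N M).+1.
have -> : x * c0_of_gr f - 1 = - ((s n - x) * c0_of_gr f) - w ^+ n.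
  by rewrite mulrBl sF opprB -addrA opprD opprK addrK.
apply: c0_ltB; first by apply: c0_ltN; apply: c0_lt_mul_gr => //; apply: HN; lia.
apply: c0_lt_le (ltW (HM n.-1 _)) _; first exact: leq_maxr.
by rewrite wn -[_ *+ _]raddfMn; apply/c0_lt_gr; exists (a ^+ n).
Qed.

End LeftInverse.

Lemma tensor_ind (A : nzRingType) (U : lmodType A^c) (V : lmodType A)
    (P : tensor U V -> Prop) :
  P 0 -> (forall s t, P s -> P t -> P (s - t)) ->
  (forall u v, P (tens u v)) -> forall t, P t.
Proof.
move=> P0 PB Pt t; rewrite -[t]reprK; move: (repr t) => m.
have PD s1 s2 : P s1 -> P s2 -> P (s1 + s2).
  by move=> P1 P2; rewrite -[s2]opprK -[- s2]sub0r; apply: (PB) => //; apply: PB.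
have PM s1 (n : int) : P s1 -> P (s1 *~ n).
  move=> P1; have Pn k : P (s1 *+ k).
    by elim: k => // k IH; rewrite mulrS; apply: PD.
  by case: n => k; [exact: Pn|rewrite NegzE mulrNz -sub0r; exact: PB P0 (Pn _)].
rewrite [m]monalgE raddf_sum; apply: (big_ind P) => // -[u v] _ /=.
by rewrite -[m@_(u, v)]intz -[_%:~R]/(1 *~ _) (raddfMz (mkmalgU (u, v))) raddfMz; apply/PM/Pt.
Qed.

Section TensorProduct.
Variables (p : nat) (p_pr : prime p) (G : groupType) (f : group_ring G).
Local Notation c0 := (c0 p_pr G).
Local Notation c0_of_gr := (@c0_of_gr p p_pr G).
Local Notation M := (cyclic_module f).
Local Open Scope quotient_scope.

(** A pure tensor u tensor b equals y tensor 1 with y = u b, and y tensor 1 = (y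
x) f tensor 1 = y x tensor f = 0 because f vanishes in M. *)
Lemma tensor_eq0_of_left_inverse (x : c0) : x * c0_of_gr f = 1 ->
  forall t : tensor c0 M, t = 0.
Proof.
move=> xf; apply: tensor_ind => [//|s t -> ->|u v]; first by rewrite subr0.
have [b ->] := cyclic_pi_surj v.
have -> : \pi_M b = b *: \pi_M 1.
  by rewrite [RHS](cyclic_scale_pi f b 1) mulr1.
rewrite -tens_balanced; set y := _ *: u.
have -> : y = (f : (group_ring G)^c) *: (y * x).
  by rewrite -[RHS]/(y * x * c0_of_gr f) -mulrA xf mulr1.
rewrite tens_balanced.
have -> : f *: \pi_M 1 = 0.
  rewrite [LHS](cyclic_scale_pi f f 1) mulr1; apply/eqP.
  rewrite -(raddf0 \pi_M) cyclic_pi_eq subr0; apply/asboolP; exists 1.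
  by rewrite mul1r.
by apply: (addrI (tens (y * x) 0)); rewrite -tensDr !addr0.
Qed.

(** The map u tensor b |-> u b is well defined with values in c0 modulo the left
ideal of f, and it sends 1 tensor 1 to the class of 1. *)
Lemma left_inverse_of_tensor_eq0 : (forall t : tensor c0 M, t = 0) ->
  exists x : c0, x * c0_of_gr f = 1.
Proof.
move=> t0; have := t0 (tens (1 : c0) (\pi_M 1)); move/eqP.
rewrite -(raddf0 \pi_(tensor c0 M)) piE Quotient.equivE subr0 => /asboolP H.
pose I := left_ideal (c0_of_gr f).
have [ev evB evU] : exists2 ev : {malg int[(c0 * M)%type]} -> c0,
    zmod_morphism ev & forall (u : c0) (v : M), ev << (u, v) >> = u * c0_of_gr (repr v).
  exists (mmap (intr : int -> c0) (fun uv => uv.1 * c0_of_gr (repr uv.2))).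
    by move=> m n; exact: raddfB.
  by move=> u v; rewrite mmapU mul1r.
have evI2 x1 x2 u1 u2 : ev x1 = u1 -> ev x2 = u2 -> u1 - u2 \in I ->
    ev (x1 - x2) \in I by move=> <- <-; rewrite evB.
have evI3 x1 x2 x3 u1 u2 u3 : ev x1 = u1 -> ev x2 = u2 -> ev x3 = u3 ->
    u1 - u2 - u3 \in I -> ev (x1 - x2 - x3) \in I by move=> <- <- <-; rewrite !evB.
have reprI (b : group_ring G) x : x * c0_of_gr (repr (\pi_M b) - b) \in I.
  have : repr (\pi_M b) - b \in left_ideal f by rewrite -cyclic_pi_eq reprK.
  move=> /asboolP[h ->]; apply/asboolP; exists (x * c0_of_gr h).
  by rewrite rmorphM mulrA.
have {H}: ev << (1, \pi_M 1) >> \in I.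
  apply: (H [pred m | ev m \in I]) => [|m []].
  - split=> [|m n mI nI]; rewrite -[_ \in _]/(ev _ \in I).
      by rewrite -(subrr 0) evB subrr rpred0.
    by rewrite evB; exact: rpredB mI nI.
  - move=> u u' v; apply: (evI3 _ _ _ _ _ _ (evU _ _) (evU _ _) (evU _ _)).
    by rewrite mulrDl addrAC addrK subrr; exact: rpred0.
  - move=> u v v'; apply: (evI3 _ _ _ _ _ _ (evU _ _) (evU _ _) (evU _ _)).
    have piD : \pi_M (repr v + repr v') = v + v' by rewrite raddfD /= !reprK.
    have := reprI (repr v + repr v') u; rewrite piD.
    by rewrite rmorphB rmorphD mulrBr mulrDr opprD addrA.
  - move=> u a v; apply: (evI2 _ _ _ _ (evU _ _) (evU _ _)).
    have := reprI (a * repr v) u; rewrite -[\pi_M _]/(a *: v).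
    rewrite -rpredN -mulrN -rmorphN opprB rmorphB rmorphM mulrBr mulrA.
    exact.
rewrite [ev _]evU mul1r => Ir; have := reprI 1 1; rewrite mul1r => I1.
have : c0_of_gr 1 \in I.
  by rewrite -[1](subKr (repr (\pi_M 1))) raddfB rpredB.
by rewrite rmorph1 => /asboolP[x ->]; exists x.
Qed.

End TensorProduct.

(** * Cosets of subgroups of finite index *)

Section Cosets.
Variable G : groupType.
Implicit Types (N : {pred G}) (g h k : G).

Lemma normal_subgroup_conj N g h : normal_subgroup N ->
  (h * g^-1)%g \in N -> (g^-1 * h)%g \in N.
Proof. by move=> [_ nN] /(nN _ g); rewrite conjgE mulgVK. Qed.

(** Finite index is about left cosets, but right multiplication acts on right
cosets, on which characters fixed by N are constant; normality identifies
the two. *)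
Lemma finite_index_cosets N : normal_subgroup N -> finite_index N ->
  exists d (r : 'I_d.+1 -> G) (c : G -> 'I_d.+1), cancel r c /\
    forall g h, c g = c h <-> (h * g^-1)%g \in N.
Proof.
move=> nN fN; have [N1 Ndiv] := nN.1.
pose C g : set G := [set (g * n)%g | n in [set` N]].
have CP g h : C g = C h <-> (h * g^-1)%g \in N.
  split=> [Cgh|hg].
    have : C h g by rewrite -Cgh; exists 1%g => //; rewrite mulg1.
    move=> [n /= nN' gE]; rewrite -gE invgM.
    have := nN.2 n^-1%g h^-1%g (group_closedV nN.1 nN').
    by rewrite conjgE invgK.
  have gh := normal_subgroup_conj nN hg.
  have NM := group_closedM nN.1.
  apply/seteqP; split=> _ [n /= nN' <-].
    exists ((g^-1 * h)^-1 * n)%g; last by rewrite invgM invgK !mulgA mulgV mul1g.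
    by apply: NM => //; apply: (group_closedV nN.1).
  exists (g^-1 * h * n)%g; last by rewrite !mulgA mulgV mul1g.
  exact: NM.
pose s : seq (set G) := fset_set (range C).
have sP g : C g \in s by rewrite in_fset_set //; apply/mem_set; exists g.
have s0 : (0 < size s)%N by rewrite -has_predT; apply/hasP; exists (C 1%g).
have nthP (i : 'I_(size s).-1.+1) : exists g, C g = nth set0 s i.
  have : nth set0 s i \in s by rewrite mem_nth // -[X in (_ < X)%N](prednK s0).
  by rewrite in_fset_set // inE => -[g _ <-]; exists g.
have [r rE] := choice nthP.
pose c g : 'I_(size s).-1.+1 := inord (index (C g) s).
have cE g : c g = index (C g) s :> nat.
  by rewrite inordK // prednK // index_mem.
exists (size s).-1, r, c; split=> [i|g h].
  apply: val_inj; rewrite /= cE rE index_uniq ?fset_uniq //.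
  by rewrite -[X in (_ < X)%N](prednK s0).
split=> [cgh|/CP Cgh]; last by apply: val_inj; rewrite /= !cE Cgh.
apply/CP; rewrite -(nth_index set0 (sP g)) -(nth_index set0 (sP h)).
by rewrite -!cE cgh.
Qed.

Lemma normal_subgroupI N N' : normal_subgroup N -> normal_subgroup N' ->
  normal_subgroup [predI N & N'].
Proof.
move=> [[N1 NB] NJ] [[N'1 N'B] N'J].
split=> [|x y]; last by rewrite !inE => /andP[/NJ-> /N'J->].
split=> [|x y]; first by rewrite inE N1.
by rewrite !inE => /andP[xN xN'] /andP[yN yN']; rewrite NB // N'B.
Qed.

Lemma finite_indexI N N' : finite_index N -> finite_index N' ->
  finite_index [predI N & N'].
Proof.
move=> fN fN'; apply: sub_finite_set (finite_image2 setI fN fN') => _ [g _ <-].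
exists [set (g * n)%g | n in [set` N]]; first by exists g.
exists [set (g * n)%g | n in [set` N']]; first by exists g.
apply/seteqP; split=> [_ [[n nN <-] [m mN /mulgI mn]]|_ [n /= /andP[nN nN'] <-]].
  by exists n => //=; rewrite inE nN -mn.
by split; exists n.
Qed.

(** The given subgroups need not form a decreasing sequence, so finite
intersections of them are used. *)
Lemma residually_finite_avoid (s : seq G) : residually_finite G -> 1%g \notin s ->
  exists N, [/\ normal_subgroup N, finite_index N & {in s, forall g, g \notin N}].
Proof.
move=> [Gam [nGam triv]]; elim: s => [_|g s IH].
  exists (fun=> true : bool); split=> //; apply: (@sub_finite_set _ _ [set setT]) => // _ [g _ <-].
  apply/seteqP; split=> // h _; exists (g^-1 * h)%g => //.
  by rewrite mulVKg.
rewrite inE negb_or => /andP[g1 /IH[N [nN fN sN]]].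
have [n gn] : exists n, g \notin Gam n.
  apply: contrapT => /forallNP gGam; case/eqP: g1; apply/esym/triv => n.
  by apply: contrapT => /negP/gGam.
exists (fun g : G => (g \in N) && (g \in Gam n)); split.
- exact: normal_subgroupI (nGam n).1.
- exact: finite_indexI (nGam n).2.
move=> h; rewrite inE -[h \notin _]/(~~ (_ && _)) negb_and => /orP[/eqP->|/sN->//].
by rewrite gn orbT.
Qed.

End Cosets.

Section CosetRepresentation.
Variables (G : groupType) (d : nat) (r : 'I_d.+1 -> G) (c : G -> 'I_d.+1).
Implicit Types (g h k : G) (u f : group_ring G).

(** The matrix of right multiplication by k on right cosets, where r chooses
representatives and c is the coset of an element. *)
Definition coset_mx k : 'M[int]_d.+1 := \matrix_(i, j) (c (r i * k)%g == j)%:R.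

Definition coset_rep u : 'M[int]_d.+1 := mmap (intr : int -> 'M_d.+1) coset_mx u.

Lemma coset_rep_zmod : zmod_morphism coset_rep.
Proof. by move=> u f; exact: raddfB. Qed.

HB.instance Definition _ := GRing.isZmodMorphism.Build (group_ring G) 'M[int]_d.+1
  coset_rep coset_rep_zmod.

Lemma coset_repU (n : int) k : coset_rep << n *g k >> = n%:~R * coset_mx k.
Proof. exact: mmapU. Qed.

Lemma coset_repE u i j :
  coset_rep u i j = \sum_(k <- msupp u | c (r i * k)%g == j) u@_k.
Proof.
rewrite /coset_rep mmapE summxE [RHS]big_mkcond /=; apply: eq_bigr => k _.
by rewrite mulrzl -scaler_int mxE mxE intz mulr_natr mulrb.
Qed.

Variables (rK : cancel r c)
  (cM : forall g h k, c g = c h -> c (g * k)%g = c (h * k)%g).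

Lemma coset_mxM k l : coset_mx (k * l)%g = coset_mx k * coset_mx l.
Proof.
apply/matrixP => i j; rewrite !mxE (bigD1 (c (r i * k)%g)) //= !mxE eqxx mul1r.
rewrite big1 ?addr0 => [|m mN]; last by rewrite !mxE eq_sym (negPf mN) mul0r.
by rewrite mulgA; congr ((_ == _)%:R); apply: cM; rewrite rK.
Qed.

Lemma coset_mx1 : coset_mx 1%g = 1.
Proof. by apply/matrixP => i j; rewrite !mxE mulg1 rK. Qed.

Lemma coset_rep_monoid : monoid_morphism coset_rep.
Proof.
split=> [|u f]; first by rewrite coset_repU coset_mx1 mulr1.
elim/gr_ind: u => [|u1 u2 H1 H2|m a].
- by rewrite mul0r raddf0 mul0r.
- by rewrite mulrDl !raddfD /= H1 H2 mulrDl.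
elim/gr_ind: f => [|u1 u2 H1 H2|n b].
- by rewrite mulr0 raddf0 mulr0.
- by rewrite mulrDr !raddfD /= H1 H2 mulrDr.
have -> : (<< m *g a >> : group_ring G) * << n *g b >> =
    << m * n *g (a * b)%g >> by exact: gr_mulUU.
rewrite !coset_repU coset_mxM rmorphM -!mulrA; congr (_ * _).
by rewrite !mulrA; congr (_ * _); rewrite mulrzl mulrzr.
Qed.

Definition coset_rep_rmorphism : {rmorphism group_ring G -> 'M[int]_d.+1} :=
  HB.pack coset_rep (GRing.isMonoidMorphism.Build (group_ring G) 'M[int]_d.+1
    coset_rep coset_rep_monoid).

Lemma coset_rep_one_sub (p : nat) (h f a : group_ring G) i l :
  h * f = (1 - a *+ p ^ l.+1) *+ p ^ i ->
  coset_rep h *m coset_rep f =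
    (p ^ i)%:Z *: (1%:M - (p ^ l.+1)%:Z *: coset_rep a).
Proof.
move=> /(congr1 coset_rep_rmorphism); rewrite rmorphM rmorphMn rmorphB rmorph1 rmorphMn.
by rewrite -scaler_nat -[_ *+ p ^ l.+1]scaler_nat !natz.
Qed.

(** The elements f h and h f differ in the group ring, but their matrices are
equally close to a scalar. *)
Lemma coset_rep_swap_mod p (p_pr : prime p) (h f a : group_ring G) i l :
  h * f = (1 - a *+ p ^ l.+1) *+ p ^ i ->
  forall m n, ((p ^ l.+1)%:Z %| coset_rep (f * h - 1 *+ p ^ i) m n)%Z.
Proof.
move=> /coset_rep_one_sub hf m n.
have q0 : (p ^ i)%:Z != 0 by rewrite eqz_nat -lt0n expn_gt0 prime_gt0.
have := mulmx_swap_mod p_pr q0 hf m n.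
suff -> : coset_rep (f * h - 1 *+ p ^ i) = coset_rep f *m coset_rep h - (p ^ i)%:Z%:M by [].
rewrite -[LHS]/(coset_rep_rmorphism _) rmorphB rmorphM rmorphMn rmorph1.
by rewrite -scaler_nat natz -[_ *: 1]/(_ *: 1%:M) scalemx1.
Qed.

End CosetRepresentation.

(** * Fixed points and residual finiteness *)

Section FixedPoints.
Variables (R : realType) (p : nat) (p_pr : prime p) (G : groupType).
Variables (f : group_ring G).
Local Open Scope quotient_scope.
Local Notation M := (cyclic_module f).
Local Notation X := (pontryagin_dual R M).

(** The values at coset representatives of a fixed character of M form a vector
killed by the matrix of h f, since h f vanishes in M. The determinant of
this matrix is a power of p times an integer prime to p, hence nonzero. *)
Lemma finite_dual_fix i (a h : group_ring G) (N : {pred G}) :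
  h * f = 1 *+ p ^ i - a *+ p ^ i.+1 ->
  normal_subgroup N -> finite_index N -> finite_set (dual_fix N : set X).
Proof.
move=> hf nN fN; have [d [r [c [rK cN]]]] := finite_index_cosets nN fN.
have cM g g' k : c g = c g' -> c (g * k)%g = c (g' * k)%g.
  by move=> /cN gg'; apply/cN; rewrite invgM !mulgA mulgK.
pose v (x : X) j := x (\pi_M (gr_elt (r j))).
have vE x g : dual_fix N x -> x (\pi_M (gr_elt g)) = v x (c g).
  move=> xN; have /cN gN : c g = c (r (c g)) by rewrite rK.
  have /(congr1 (fun y : X => y (\pi_M (gr_elt g)))) := xN _ (group_closedV nN.1 gN).
  rewrite /= invgK -[_ *: _]/(cyclic_scale _ _) cyclic_scale_pi -gr_eltM.
  by rewrite mulgVK => <-.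
have vU x n g : dual_fix N x -> x (\pi_M << n *g g >>) = v x (c g) *~ n.
  move=> xN; have -> : << n *g g >> = gr_elt g *~ n.
    by apply: etrans (raddfMz (mkmalgU g) n 1); rewrite intz.
  by rewrite (raddfMz \pi_M) (raddfMz (dual_val x)) -vE.
have v_inj x y : dual_fix N x -> dual_fix N y -> v x = v y -> x = y.
  move=> xN yN vxy; apply: dual_eqP => m; have [u ->] := cyclic_pi_surj m.
  elim/gr_ind: u => [|u1 u2 H1 H2|n g]; first by rewrite !raddf0.
    by rewrite (raddfD \pi_M) (raddfD (dual_val x)) (raddfD (dual_val y)) /= H1 H2.
  by rewrite !vU // vxy.
pose D := \det (coset_rep r c (h * f)).
have D0 : D != 0.
  have hf1 : h * f = (1 - a *+ p ^ 1) *+ p ^ i by rewrite hf mulrnBl -mulrnA -expnD.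
  rewrite /D [coset_rep _ _ _](rmorphM (coset_rep_rmorphism rK cM)).
  rewrite -[_ * _]/(_ *m _) (coset_rep_one_sub rK cM hf1) detZ.
  rewrite mulf_neq0 ?expf_neq0 ?eqz_nat -?lt0n ?expn_gt0 ?prime_gt0 //.
  apply: contraTneq (det_one_sub_coprime p_pr (coset_rep r c a)).
  rewrite expn1 => ->; rewrite coprimezE /coprime gcdn0 /=.
  by rewrite neq_ltn prime_gt1 ?orbT.
have vD x : dual_fix N x -> forall j, v x j *+ `|D|%N = 0.
  move=> xN j; have vD0 : v x j *~ D = 0.
    apply: mulmx_torsion => k.
    have E u : \sum_l v x l *~ coset_rep r c u k l = x (\pi_M (gr_elt (r k) * u)).
      elim/gr_ind: u => [|u1 u2 H1 H2|n g].
      - by rewrite mulr0 !raddf0 big1 // => l _; rewrite mxE.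
      - rewrite mulrDr (raddfD \pi_M) (raddfD (dual_val x)) /= -H1 -H2 -big_split.
        apply: eq_bigr => l _ /=; rewrite raddfD /=.
        by rewrite mxE mulrzDr.
      have -> : gr_elt (r k) * << n *g g >> = << n *g (r k * g)%g >>.
        by rewrite [LHS]gr_mulUU mul1r.
      rewrite vU // (bigD1 (c (r k * g)%g)) //= big1 ?addr0 => [|l lN].
        by rewrite coset_repU mulrzl -scaler_int mxE mxE eqxx intz mulr1.
      by rewrite coset_repU mulrzl -scaler_int mxE mxE eq_sym (negPf lN) mulr0 mulr0z.
    rewrite E mulrA; suff -> : \pi_M (gr_elt (r k) * h * f) = 0 by rewrite raddf0.
    apply/eqP; rewrite -(raddf0 \pi_M) cyclic_pi_eq subr0; apply/asboolP.
    by eexists.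
  by apply/eqP; rewrite pmulrn abszEsign mulrC mulrzA vD0 mul0rz.
have n0 : (0 < `|D|)%N by rewrite absz_gt0.
pose e (k : {ffun 'I_d.+1 -> 'I_`|D|}) j := \pi_(circle R) ((k j)%:R / (`|D|%N)%:R).
pose y k : X := xget 0 [set x : X | dual_fix N x /\ v x = e k].
apply: (@sub_finite_set _ _ (range y)); last exact: finite_image.
move=> x xN; have [k kE] := choice (fun j => circle_torsionP n0 (vD x xN j)).
exists [ffun j => k j] => //.
have vx : v x = e [ffun j => k j] by apply/funext => j; rewrite kE /e ffunE.
rewrite /y; case: xgetP => [z _ [zN vz]|/(_ x)]; last by case.
by apply: v_inj; rewrite // vz vx.
Qed.

End FixedPoints.

Section ResiduallyFinite.
Variables (p : nat) (p_pr : prime p) (G : groupType) (G_rf : residually_finite G).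
Local Notation c0_of_gr := (@c0_of_gr p p_pr G).
Implicit Types (f u : group_ring G).

(** Choose N such that no other element of the support of u lies in the coset of
g. The matrix entry from the coset of 1 to the coset of g is then the
coefficient of u at g. *)
Lemma gr_dvd_of_cosets u (n : nat) :
  (forall d (r : 'I_d.+1 -> G) (c : G -> 'I_d.+1), cancel r c ->
     (forall g g' k : G, c g = c g' -> c (g * k)%g = c (g' * k)%g) ->
     forall i j, (n%:Z %| coset_rep r c u i j)%Z) ->
  forall g, (n%:Z %| u@_g)%Z.
Proof.
move=> nu g; pose s := [seq (h * g^-1)%g | h <- msupp u & h != g].
have [|N [nN fN sN]] := residually_finite_avoid (s := s) G_rf.
  apply/mapP => -[h]; rewrite mem_filter => /andP[/eqP hg _] hgE; apply: hg.
  by rewrite -[h](mulgVK g) -hgE mul1g.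
have [d [r [c [rK cN]]]] := finite_index_cosets nN fN.
have cM g1 g2 k : c g1 = c g2 -> c (g1 * k)%g = c (g2 * k)%g.
  by move=> /cN g12; apply/cN; rewrite invgM !mulgA mulgK.
have := nu d r c rK cM (c 1%g) (c g); rewrite coset_repE.
have cr h : c (r (c 1%g) * h)%g = c h by rewrite (cM _ 1%g) ?mul1g ?rK.
have cg h : h \in msupp u -> (c h == c g) = (h == g).
  move=> hu; apply/eqP/eqP => [|->//] /esym/cN hN; apply/eqP; apply: contraT => hg.
  have /sN/negP[] // : (h * g^-1)%g \in s.
  by apply/mapP; exists h; rewrite // mem_filter hg.
rewrite big_seq_cond (eq_bigl (fun h => (h \in msupp u) && (h == g))); last first.
  by move=> h /=; rewrite cr; case: (boolP (h \in _)) => //= /cg ->.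
have [gu|gu] := boolP (g \in msupp u); last by rewrite mcoeff_outdom ?dvdz0.
rewrite -big_seq_cond big_mkcond (big_fsetD1 g) //= eqxx big1_fset ?addr0 // => h.
by rewrite !inE => /andP[/negPf -> _].
Qed.

(** The congruence for h f modulo p^(N+1) passes to f h in all finite quotients,
hence in the group ring. Therefore p^i (f x - 1) is small, as h is close to
p^i x, and N is arbitrary. *)
Lemma c0_right_inverse (x : c0 p_pr G) f : x * c0_of_gr f = 1 -> c0_of_gr f * x = 1.
Proof.
move=> xf; have [i Hi] := c0_left_inverse_approx xf.
suff E : (c0_of_gr f * x - 1) *+ p ^ i = 0.
  have pi0 : (p ^ i)%N%:R != 0 :> Qp p_pr.
    rewrite -qp_norm_eq0 -[_%:R]/((p ^ i)%N%:~R) qp_norm_int gt_eqF //.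
    by rewrite padic_abs_neq0 // intr_eq0 eqz_nat -lt0n expn_gt0 prime_gt0.
  apply/eqP; rewrite -subr_eq0; apply/eqP/c0P => g; apply: (mulIf pi0).
  by rewrite mul0r mulr_natr -c0_mulrnE E.
apply: c0_lt_eq0 => e e0; have [N HN] := pexpN_small p_pr e0.
have [h [a [hf hx]]] := Hi (i + N)%N.
have hf' : h * f = (1 - a *+ p ^ N.+1) *+ p ^ i.
  by rewrite hf mulrnBl -mulrnA -expnD addSn addnC.
have -> : (c0_of_gr f * x - 1) *+ p ^ i =
    c0_of_gr f * (x *+ p ^ i - c0_of_gr h) + c0_of_gr (f * h - 1 *+ p ^ i).
  by rewrite mulrBr mulrnAr rmorphB rmorphM rmorphMn rmorph1 addrA subrK mulrnBl.
apply: c0_ltD.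
  apply: c0_lt_gr_mul => //; apply: c0_lt_le hx; apply/ltW/HN; exact: leq_addl.
apply: c0_lt_le (ltW (HN N (leqnn N))) _; apply/c0_lt_gr/gr_divisible_ex.
apply: gr_dvd_of_cosets => d r c rK cM.
by have := coset_rep_swap_mod rK cM p_pr hf'.
Qed.

End ResiduallyFinite.

Theorem theorem14 (R : realType) (p : nat) (p_pr : prime p)
  (G : groupType) (G_countable : countable [set: G]) (f : group_ring G) :
  let M_f := cyclic_module f in
  let X_f := pontryagin_dual R M_f in
  let cond_a := bounded_torsion p X_f in
  let cond_b := exists g : c0 p_pr G, g * c0_of_gr p_pr f = 1 in
  let cond_c := forall t : tensor (c0 p_pr G) M_f, t = 0 in
  let cond_d := c0_of_gr p_pr f \is a GRing.unit in
  [/\ cond_a <-> cond_b,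
      cond_b <-> cond_c,
      cond_a -> forall N : {pred G}, normal_subgroup N -> finite_index N ->
        finite_set (dual_fix N : set X_f)
    & residually_finite G -> (cond_a <-> cond_d)].
Proof.
move=> M_f X_f cond_a cond_b cond_c cond_d.
have ab : cond_a <-> cond_b.
  split=> [/(bounded_torsion_congruence p_pr)[i [a [h hf]]]|[x xf]].
    exact: c0_left_inverse_ex hf.
  have [i Hi] := c0_left_inverse_approx xf.
  have [h [a [hf _]]] := Hi i.
  exact: congruence_bounded_torsion hf.
split=> // [|/(bounded_torsion_congruence p_pr)[i [a [h hf]]] N nN fN|G_rf].
- split=> [[x xf]|]; first exact: tensor_eq0_of_left_inverse xf.
  exact: left_inverse_of_tensor_eq0.
- exact (finite_dual_fix R p_pr hf nN fN).
- rewrite ab; split=> [[x xf]|fU].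
    by apply/unitrP; exists x; split=> //; exact: c0_right_inverse xf.
  by exists (c0_of_gr p_pr f)^-1; rewrite mulVr.
Qed.
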